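(* Let $d\ge1$ be an integer. For every $p\in[0,d)$ the sets $$\{A\in\mathbf{K}([0,1]^d) : \dim_{\mathcal H}(A)>p\}\quad\text{and}\quad \{A\in\mathbf{K}([0,1]^d) : \dim_{\mathrm F}(A)>p\}$$ are $\boldsymbol{\Sigma}^0_2$-complete.
   Context: $\mathbf{K}([0,1]^d)$ is the space of compact subsets of $[0,1]^d$ (including $\emptyset$) with the Vietoris topology, i.e. the topology generated by the sets $\{F : F\cap C=\emptyset\}$ ($C$ closed) and $\{F: F\cap U\neq\emptyset\}$ ($U$ open); it is Polish. For $A\subset\mathbb{R}^d$, the Hausdorff dimension is $\dim_{\mathcal H}(A)=\sup\{s\ge 0:\mathcal H^s(A)>0\}$, where $\mathcal H^s$ is $s$-dimensional Hausdorff measure. $\mathbb{P}(A)$ denotes the set of Borel probability measures on $\mathbb{R}^d$ with support included in $A$; $\widehat\mu(\xi)=\int_{\mathbb{R}^d} e^{-i\,\xi\cdot x}\,d\mu(x)$. The Fourier dimension (relative to the ambient space $\mathbb{R}^d$) is $\dim_{\mathrm F}(A)=\sup\{s\in[0,d] : (\exists\mu\in\mathbb{P}(A))(\exists c>0)(\forall x\in\mathbb{R}^d, x\ne 0)\ |\widehat\mu(x)|\le c|x|^{-s/2}\}$. Convention: $\sup\emptyset=0$ in both definitions. Borel hierarchy: $\boldsymbol\Sigma^0_1$ are the open sets, $\boldsymbol\Pi^0_1$ the closed sets; $\boldsymbol\Sigma^0_\xi$ sets ($\xi>1$) are countable unions of sets each in some $\boldsymbol\Pi^0_{\eta}$ with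 $\eta<\xi$; $\boldsymbol\Pi^0_\xi$ sets are complements of $\boldsymbol\Sigma^0_\xi$ sets. For $A\subset X$, $B\subset Y$ write $A\le_W B$ if there is a continuous $f:X\to Y$ with $x\in A\iff f(x)\in B$. For $Y$ Polish, $B\subset Y$ is $\boldsymbol\Gamma$-hard if $A\le_W B$ for every $A\in\boldsymbol\Gamma(X)$ and every Polish $X$ having a basis of clopen sets; it is $\boldsymbol\Gamma$-complete if it is $\boldsymbol\Gamma$-hard and $B\in\boldsymbol\Gamma(Y)$. *)

(* Defs.v *)
From HB Require Import structures.
From mathcomp Require Import all_boot all_order all_algebra.
From mathcomp Require Import all_classical all_reals all_analysis.
From mathcomp Require Import borel_hierarchy complex.

Set Implicit Arguments.
Unset Strict Implicit.
Unset Printing Implicit Defensive.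

Import Order.TTheory GRing.Theory Num.Theory.
Import numFieldNormedType.Exports.

Local Open Scope classical_set_scope.
Local Open Scope ring_scope.

Definition pointclass := forall X : topologicalType, set (set X).

(* Sigma^0_2: countable unions of Pi^0_1 (i.e. closed) sets. The empty and
   finite unions are covered by the nat-indexed ones, as set0 is closed. *)
Definition Sigma02 : pointclass := fun X => @Fsigma X.

Definition complete_metric (R : realType) (X : topologicalType)
    (rho : X -> X -> R) :=
  [/\ forall x y, rho x y = 0 <-> x = y,
      forall x y, rho x y = rho y x,
      forall x y z, rho x z <= rho x y + rho y z,
      (forall x, nbhs x =
        filter_from [set e : R | 0 < e] (fun e => [set y | rho x y < e])) &
      forall u : nat -> X,
        (forall e : R, 0 < e -> exists N : nat, forall m n : nat,
          (N <= m)%N -> (N <= n)%N -> rho (u m) (u n) < e) ->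
        exists l : X, u @ \oo --> l].

(* Separable and completely metrizable; the empty space is allowed. *)
Definition Polish (R : realType) (X : topologicalType) :=
  (exists2 S : set X, countable S & dense S) /\
  (exists rho : X -> X -> R, complete_metric rho).

(* The library's [zero_dimensional] only says that points are separated by
   clopen sets, which is weaker in general. *)
Definition has_clopen_basis (X : topologicalType) :=
  exists2 B : set (set X), basis B & B `<=` clopen.

Definition wadge_le (X Y : topologicalType) (A : set X) (B : set Y) :=
  exists2 f : X -> Y, continuous f & forall x, A x <-> B (f x).

Definition pointclass_hard (R : realType) (Gamma : pointclass) (Y : topologicalType)
    (B : set Y) :=
  forall X : topologicalType, Polish R X -> has_clopen_basis X ->
  forall A : set X, Gamma X A -> wadge_le A B.

(* [R] only serves as the set of values of metrics in [Polish]. *)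
Definition pointclass_complete (R : realType) (Gamma : pointclass)
    (Y : topologicalType) (B : set Y) :=
  pointclass_hard R Gamma B /\ Gamma Y B.

Record hyperspace (X : topologicalType) := Hyperspace {
  hset :> set X ;
  hset_compact : compact hset
}.

HB.instance Definition _ (X : topologicalType) := gen_eqMixin (hyperspace X).
HB.instance Definition _ (X : topologicalType) :=
  gen_choiceMixin (hyperspace X).

Definition vietoris_subbase (X : topologicalType) :
    set (set (hyperspace X)) :=
  [set [set F : hyperspace X | hset F `&` C = set0] | C in @closed X] `|`
  [set [set F : hyperspace X | hset F `&` U !=set0] | U in @open X].

HB.instance Definition _ (X : topologicalType) :=
  isSubBaseTopological.Build (hyperspace X) (@vietoris_subbase X) id.

Section euclidean.
Context (R : realType) (d : nat).
Implicit Types (x y : 'rV[R]_d) (A : set 'rV[R]_d).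

Definition dotp x y : R := \sum_(i < d) x ord0 i * y ord0 i.

(* The library's norm on matrices is the sup norm. *)
Definition enorm x : R := Num.sqrt (dotp x x).

Definition unit_cube : set 'rV[R]_d :=
  [set x | forall i, 0 <= x ord0 i <= 1].

Local Open Scope ereal_scope.

Definition ediam A : \bar R :=
  ereal_sup [set (enorm (xy.1 - xy.2)%R)%:E | xy in A `*` A].

(* diam(A)^s with the conventions that the empty set has weight 0 and that
   0^0 = 1 (so that H^0 is the counting measure). *)
Definition diam_pow (s : R) A : \bar R :=
  if A == set0 then 0 else ediam A `^ s.

Definition hausdorff_premeasure (s delta : R) A : \bar R :=
  ereal_inf [set \sum_(0 <= k <oo) diam_pow s (U k) |
    U in [set U : nat -> set 'rV[R]_d |
      A `<=` \bigcup_k U k /\ forall k, ediam (U k) <= delta%:E]].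

Definition hausdorff_measure (s : R) A : \bar R :=
  ereal_sup [set hausdorff_premeasure s delta A |
    delta in [set delta : R | (0 < delta)%R]].

(* The maximum with 0 implements the convention sup set0 = 0: the ereal_sup of
   the empty set is -oo, and all the elements of the set are nonnegative. *)
Definition hausdorff_dim A : \bar R :=
  maxe 0 (ereal_sup [set s%:E | s in
    [set s : R | (0 <= s)%R /\ 0 < hausdorff_measure s A]]).

Definition borel_rV := g_sigma_algebraType (@open 'rV[R]_d).

Definition msupport (mu : set 'rV[R]_d -> \bar R) : set 'rV[R]_d :=
  [set x | forall U, open_nbhs x U -> 0 < mu U].

Local Close Scope ereal_scope.

Definition cexpi (t : R) : R[i] := Complex (cos t) (sin t).

Definition cintegral (mu : probability borel_rV R) (f : 'rV[R]_d -> R[i]) :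
    R[i] :=
  Complex (\int[mu]_x complex.Re (f x)) (\int[mu]_x complex.Im (f x)).

Definition fourier_transform (mu : probability borel_rV R) (xi : 'rV[R]_d) :
    R[i] :=
  cintegral mu (fun x => cexpi (- dotp xi x)).

(* This is a subset of [0, d], on which [sup] is the actual supremum except for
   the convention sup set0 = 0. *)
Definition fourier_dim A : R :=
  sup [set s : R | 0 <= s <= d%:R /\
    exists mu : probability borel_rV R, msupport mu `<=` A /\
    exists2 c : R, 0 < c & forall x : 'rV[R]_d, x != 0 ->
      Normc.normc (fourier_transform mu x) <= c * enorm x `^ (- s / 2)].

End euclidean.

(* [0,1]^d is the type of points of [unit_cube] with the subspace topology. *)
Definition K_cube (R : realType) (d : nat) : topologicalType :=
  hyperspace (set_type (@unit_cube R d)).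

Definition ambient (R : realType) (d : nat) (A : K_cube R d) :
    set 'rV[R]_d :=
  [set set_val x | x in hset A].

(* Main.v *)
Require Import Defs.
From HB Require Import structures.
From mathcomp Require Import all_boot all_order all_algebra.
From mathcomp Require Import all_classical all_reals all_analysis.
From mathcomp Require Import measurable_realfun complex.
From mathcomp Require Import lra ring.
Set Implicit Arguments.
Unset Strict Implicit.
Unset Printing Implicit Defensive.
Import Order.TTheory GRing.Theory Num.Theory.
Import numFieldNormedType.Exports.
Local Open Scope classical_set_scope.
Local Open Scope ring_scope.

(** Both sets are countable unions of closed sets, each for its own
    compactness reason, and a single continuous reduction shows that both are
    hard.

    Hausdorff dimension, upper bound.  A compact set A has dimension greater
    than p exactly when, for some q > p taken from a sequence decreasing to p,
    the sums of the q-th powers of the diameters in an open cover of A stay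
    away from 0 ([hausdorff_le0], [small_coverP]).  An open cover of A also
    covers every compact set close to A, so the sets with a cover of small
    weight form an open set ([open_small_cover]).

    Fourier dimension, upper bound.  For a fixed exponent q and a fixed
    constant c, the compact sets carrying a probability whose transform is at
    most c|x|^(-q/2) form a closed set ([decay_set_closed]), because
    probabilities on the cube are weakly compact.  For a limit along an
    ultrafilter of compact sets E converging to A, with a probability mu_E for
    each of them, the limits of mu_E(U) for U open are regularized from inside
    and then extended to an outer measure.  Open sets
    are Caratheodory measurable for it ([open_caratheodory]), so it restricts
    to a Borel probability nu, and nu(U) is at most the limit of mu_E(U) for
    every open U ([weak_limit_exists]).  Slicing a continuous function along
    its superlevel sets turns this inequality into convergence of integrals
    ([Rintegral_wlim]); decay and support then pass to the limit.

    Hardness.  Let a countable union of closed sets C_n be given in a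
    zero-dimensional Polish space.  The complement of C_n splits into disjoint
    clopen stages D_(n,k) ([closed_stages]).  A point x is sent to the union
    over n of pieces contained in the boxes [0, 1/(n+1)]^d: the n-th piece is
    the whole box when x is in C_n, and a finite grid of mesh 1/(n+1)/(k+1) in
    it when x is in D_(n,k).  The map is continuous ([cube_map_continuous])
    since the grids tend to the box as k grows, since points close to C_n are
    in late stages, and since the boxes shrink to the origin.  Its value
    contains a box when x lies in some C_n and is countable otherwise, so it
    only remains to compare these two cases ([Sigma02_hard_of_box]).

    A countable compact set has both dimensions 0: for the Fourier dimension,
    a decaying transform forbids atoms, by averaging it against a Fejer kernel
    ([decay_no_atom]).  A box has both dimensions d.  This is seen on the
    probabilities [box_prob], distributions of sums of independent vectors,
    each uniform on a segment parallel to a coordinate axis.  With one segment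
    per axis this is the uniform law on a box, and the mass distribution
    principle applies ([box_hausdorff_dim]).  With d segments per axis the
    transform is O(|x|^(-d)) at infinity, which is more than enough
    ([box_fourier_dim]). *)

(** * Rational balls and Borel sets *)

Lemma inv_nat_lt (R : realType) (e : R) : 0 < e ->
  exists n : nat, n.+1%:R^-1 < e.
Proof.
move=> e0; have [n _ hn] := near_infty_natSinv_lt (PosNum e0).
by exists n; exact: (hn n (leqnn n)).
Qed.

Section euclidean_space.
Variables (R : realType) (d : nat).
Local Notation V := 'rV[R]_d.

Lemma rV_ballP (x y : V) e : 0 < e ->
  ball x e y <-> forall i, `|x ord0 i - y ord0 i| < e.
Proof.
move=> e0; split=> [[_ h] i|h]; first exact: h.
by split=> // i j; rewrite (ord1 i); exact: h.
Qed.

Definition rat_ball (k : 'rV[rat]_d * nat) : set V :=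
  ball (map_mx ratr k.1 : V) k.2.+1%:R^-1.

(** Density of the rationals, one coordinate at a time. *)
Lemma rat_ball_exists (x : V) e : 0 < e ->
  exists k, rat_ball k x /\ rat_ball k `<=` ball x e.
Proof.
move=> e0; have [n hn] := inv_nat_lt (divr_gt0 e0 (ltr0n R 2)).
have n0 : 0 < n.+1%:R^-1 :> R by rewrite invr_gt0.
have hq i : exists q : rat, `|ratr q - x ord0 i| < n.+1%:R^-1.
  have [|q] := @rat_in_itvoo R (x ord0 i - n.+1%:R^-1) (x ord0 i + n.+1%:R^-1).
    by rewrite ltrBlDr -addrA ltrDl addr_gt0.
  by rewrite in_itv/= => h; exists q; move: h n0; move: (n.+1%:R^-1) => r;
    rewrite ltr_norml; lra.
have [q hq'] := choice hq.
exists (\row_i q i, n); split; first by apply/rV_ballP => // i; rewrite !mxE.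
move=> y /rV_ballP -/(_ n0) hy; apply/rV_ballP => // i.
move: hn (hy i) (hq' i); rewrite !mxE !ltr_norml; move: (n.+1%:R^-1) => r; lra.
Qed.

(** As there are countably many rational balls, this is second countability in
    the form in which measurability and null sets use it. *)
Lemma open_bigcup_rat_ball (U : set V) : open U ->
  U = \bigcup_(k in [set k | rat_ball k `<=` U]) rat_ball k.
Proof.
move=> oU; apply/seteqP; split=> [x Ux|x [k]]; last exact.
have /nbhs_ballP[e /= e0 he] : nbhs x U by exact: open_nbhs_nbhs.
have [k [kx ke]] := rat_ball_exists x e0.
by exists k => //; exact: subset_trans he.
Qed.

End euclidean_space.

Section borel.
Variables (R : realType) (d : nat).
Local Notation V := 'rV[R]_d.
Local Notation B := (borel_rV R d).

Lemma open_measurable_rV (U : set V) : open U -> measurable (U : set B).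
Proof. by move=> oU; exact: sub_sigma_algebra. Qed.

Lemma closed_measurable_rV (C : set V) : closed C -> measurable (C : set B).
Proof.
move=> /closed_openC/open_measurable_rV mC.
by rewrite -(setCK C); exact: measurableC.
Qed.

Lemma continuous_measurable_rV (g : V -> R) : continuous g ->
  measurable_fun [set: B] g.
Proof.
move=> /continuousP cg.
apply: (measurability _ (RGenOpens.measurableE R)) => _ [_ [a [b ->] <-]].
by rewrite setTI; apply: open_measurable_rV; apply: cg; exact: interval_open.
Qed.

Lemma coord_continuous_rV (i : 'I_d) : continuous (fun x : V => x ord0 i).
Proof. exact: coord_continuous. Qed.

(** Rational balls suffice as test sets, and a ball for the sup norm is a finite
    intersection of conditions on coordinates. *)
Lemma measurable_fun_row dT (T : measurableType dT) (f : T -> V) :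
  (forall i, measurable_fun setT (fun t => f t ord0 i)) ->
  measurable_fun setT (f : T -> B).
Proof.
move=> mf; apply: (@measurability _ _ T B setT f (@open V) erefl) => _ [U oU <-].
rewrite setTI (open_bigcup_rat_ball oU) bigcup_mkcond preimage_bigcup.
apply: countable_bigcupT_measurable => [|k]; first exact: countableP.
case: ifPn => _; last by rewrite preimage_set0.
have -> : f @^-1` rat_ball k =
    \bigcap_(i in [set: 'I_d])
      [set t | `|ratr (k.1 ord0 i) - f t ord0 i| < k.2.+1%:R^-1].
  apply/seteqP; split=> t /=.
    by move=> /rV_ballP h i _ /=; have := h ltac:(by rewrite invr_gt0) i;
      rewrite mxE.
  by move=> h; apply/rV_ballP => [|i]; [rewrite invr_gt0|rewrite mxE; exact: h].
apply: fin_bigcap_measurable => // i _.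
pose g t : R := `|ratr (k.1 ord0 i) - f t ord0 i|.
have mg : measurable_fun setT g.
  by apply: measurableT_comp => //; exact: measurable_funB.
have := mg measurableT _ (measurable_itv `]-oo, k.2.+1%:R^-1[).
by rewrite setTI preimage_itvNyo.
Qed.

(** The complement of A is covered by null neighbourhoods, hence by countably
    many null rational balls. *)
Lemma msupport_null (mu : probability B R) (A : set V) : closed A ->
  msupport mu `<=` A -> mu (~` A) = 0%E.
Proof.
move=> cA sA; have oA : open (~` A) by exact: closed_openC.
have mA := open_measurable_rV oA.
apply: (@measure_negligible _ _ _ mu) => //.
(* The empty set replaces the balls that are not null. *)
pose W (k : 'rV[rat]_d * nat) : set B :=
  if mu (rat_ball k) == 0%E then rat_ball k else set0.
have mW k : measurable (W k).
  rewrite /W; case: ifP => // _; apply: open_measurable_rV.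
  by apply: ball_open; rewrite invr_gt0.
pose F n : set B := if unpickle n is Some k then W k else set0.
have nF : mu.-negligible (\bigcup_n F n).
  apply: negligible_bigcup => n; rewrite /F.
  case: unpickle => [k|]; last exact: negligible_set0.
  apply/negligibleP => //; rewrite /W; case: ifP => [/eqP//|_]; exact: measure0.
apply: negligibleS nF => x /= Ax.
have /existsNP[U /not_implyP[[oU Ux] /negP]] : ~ msupport mu x by move=> /sA.
rewrite -leNgt => muU.
have /nbhs_ballP[e /= e0 he] : nbhs x U by exact: open_nbhs_nbhs.
have [k [kx ke]] := rat_ball_exists x e0.
exists (pickle k) => //; rewrite /F pickleK /W ifT//.
rewrite eq_le measure_ge0 andbT; apply: le_trans muU.
apply: le_measure; rewrite ?inE;
  [|exact: open_measurable_rV|exact: subset_trans he].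
by apply: open_measurable_rV; apply: ball_open; rewrite invr_gt0.
Qed.

Lemma null_msupport (mu : probability B R) (A : set V) : closed A ->
  mu (~` A) = 0%E -> msupport mu `<=` A.
Proof.
move=> cA muA x sx; apply: contrapT => nAx.
have : (0 < mu (~` A))%E by apply: sx; split => //; exact: closed_openC.
by rewrite muA ltxx.
Qed.

End borel.

(** * Integrals of bounded functions against a probability *)

Section bounded_measurable.
Context dT (T : measurableType dT) (R : realType).
Implicit Types (f g : T -> R) (P : probability T R).

Definition bounded_meas f :=
  measurable_fun setT f /\ exists M, forall x, `|f x| <= M.

Lemma bounded_meas_cst (c : R) : bounded_meas (fun=> c).
Proof. by split; [exact: measurable_cst|exists `|c|]. Qed.

Lemma bounded_measD f g : bounded_meas f -> bounded_meas g ->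
  bounded_meas (fun x => f x + g x).
Proof.
move=> [mf [M hM]] [mg [N hN]]; split; first exact: measurable_funD.
by exists (M + N) => x; rewrite (le_trans (ler_normD _ _))// lerD.
Qed.

Lemma bounded_measM f g : bounded_meas f -> bounded_meas g ->
  bounded_meas (fun x => f x * g x).
Proof.
move=> [mf [M hM]] [mg [N hN]]; split; first exact: measurable_funM.
by exists (M * N) => x; rewrite normrM ler_pM.
Qed.

Lemma bounded_measN f : bounded_meas f -> bounded_meas (fun x => - f x).
Proof.
move=> bf; have := bounded_measM (bounded_meas_cst (-1)) bf.
by congr bounded_meas; apply/funext => x; rewrite mulN1r.
Qed.

Lemma bounded_meas_sum (I : Type) (s : seq I) (h : I -> T -> R) :
  (forall i, bounded_meas (h i)) -> bounded_meas (fun x => \sum_(i <- s) h i x).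
Proof.
move=> bh; elim: s => [|i s IH].
  by under eq_fun do rewrite big_nil; exact: bounded_meas_cst.
by under eq_fun do rewrite big_cons; exact: bounded_measD.
Qed.

Lemma bounded_meas_indic (A : set T) : measurable A -> bounded_meas (\1_A : T -> R).
Proof.
move=> mA; split; first exact: measurable_indic.
by exists 1 => x; rewrite indicE; case: (_ \in _); rewrite ?normr1 ?normr0.
Qed.

Section integral.
Variable P : probability T R.

Lemma bounded_meas_integrable f : bounded_meas f -> P.-integrable setT (EFin \o f).
Proof.
move=> [mf [M hM]]; apply: measurable_bounded_integrable => //.
  by rewrite (le_lt_trans (probability_le1 P measurableT)) ?ltry.
exists M; split; first exact: num_real.
by move=> x Mx t _ /=; apply: le_trans (hM t) (ltW Mx).
Qed.

Lemma Rintegral_prob_cst (c : R) : \int[P]_x c = c.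
Proof. by rewrite Rintegral_cst//= (probability_setT P) mulr1. Qed.

Lemma Rintegral_prob_indic (A : set T) : measurable A ->
  \int[P]_x (\1_A x : R) = fine (P A).
Proof. by move=> mA; rewrite /Rintegral integral_indic// setIT. Qed.

Lemma Rintegral_bounded_meas_le f g : bounded_meas f -> bounded_meas g ->
  (forall x, f x <= g x) -> \int[P]_x f x <= \int[P]_x g x.
Proof.
by move=> bf bg fg; apply: le_Rintegral => //; exact: bounded_meas_integrable.
Qed.

Lemma Rintegral_bounded_measD f g : bounded_meas f -> bounded_meas g ->
  \int[P]_x (f x + g x) = \int[P]_x f x + \int[P]_x g x.
Proof. by move=> bf bg; rewrite RintegralD//; exact: bounded_meas_integrable. Qed.

Lemma Rintegral_bounded_measZ c f : bounded_meas f ->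
  \int[P]_x (c * f x) = c * \int[P]_x f x.
Proof. by move=> bf; rewrite RintegralZl//; exact: bounded_meas_integrable. Qed.

Lemma Rintegral_bounded_meas_sum (I : Type) (s : seq I) (h : I -> T -> R) :
  (forall i, bounded_meas (h i)) ->
  \int[P]_x (\sum_(i <- s) h i x) = \sum_(i <- s) \int[P]_x h i x.
Proof.
move=> bh; elim: s => [|i s IH].
  by under eq_Rintegral do rewrite big_nil; rewrite big_nil Rintegral_prob_cst.
under eq_Rintegral do rewrite big_cons.
by rewrite big_cons Rintegral_bounded_measD ?IH//; exact: bounded_meas_sum.
Qed.

Lemma Rintegral_prob_bound f M : bounded_meas f -> (forall x, `|f x| <= M) ->
  `|\int[P]_x f x| <= M.
Proof.
move=> bf fM.
rewrite ler_norml -[leLHS]Rintegral_prob_cst.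
rewrite -[X in _ && (_ <= X)]Rintegral_prob_cst.
by apply/andP; split; apply: Rintegral_bounded_meas_le => //;
  try exact: bounded_meas_cst;
  move=> x; move: (fM x); rewrite ler_norml => /andP[].
Qed.

End integral.
End bounded_measurable.

(** * Weak limits of probabilities along an ultrafilter *)

Lemma ultra_fmap (I J : Type) (f : I -> J) (F : set_system I) :
  UltraFilter F -> UltraFilter (f i @[i --> F]).
Proof.
move=> FU; split; first exact: fmap_proper_filter.
move=> G GP FG; apply/seteqP; split=> // A GA.
have [//|nA] := in_ultra_setVsetC (f @^-1` A) FU.
exfalso; apply: (@filter_not_empty _ G); rewrite -(setICr A).
by apply: filterI => //; exact: FG.
Qed.

(** This is what ultrafilters are for here: every bounded family of reals has a
    limit, so no subsequences have to be extracted. *)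
Lemma ultra_bounded_cvg (R : realType) (I : Type) (F : set_system I)
    (f : I -> R) (M : R) : UltraFilter F -> (forall i, `|f i| <= M) ->
  cvg (f i @[i --> F]).
Proof.
move=> FU fM.
have UG : UltraFilter (f i @[i --> F]) by exact: ultra_fmap.
have := @segment_compact R (- M) M; rewrite compact_ultra => /(_ _ UG)[].
  rewrite /nbhs/=; apply: (@filterE _ F) => i /=.
  by rewrite in_itv/= -ler_norml.
by move=> l [_ fl]; apply/cvg_ex; exists l.
Qed.

Section weak_limit.
Variables (R : realType) (d : nat) (I : Type) (F : set_system I).
Context {FU : UltraFilter F}.
Local Notation V := 'rV[R]_d.
Local Notation B := (borel_rV R d).
Variable mu : I -> probability B R.

Definition ulim (f : I -> R) : R := lim (f i @[i --> F]).

Lemma ulim_le (f g : I -> R) M : (forall i, `|f i| <= M) ->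
  (forall i, `|g i| <= M) -> (forall i, f i <= g i) -> ulim f <= ulim g.
Proof.
move=> hf hg fg; have cf := ultra_bounded_cvg FU hf.
have cg := ultra_bounded_cvg FU hg.
rewrite -subr_ge0 /ulim -limB//; apply: limr_ge; first exact: is_cvgB.
by apply: filterE => i; rewrite subr_ge0.
Qed.

Lemma ulim_cst (c : R) : ulim (fun=> c) = c.
Proof. exact: lim_cst. Qed.

Lemma ulimD (f g : I -> R) M : (forall i, `|f i| <= M) ->
  (forall i, `|g i| <= M) -> ulim (fun i => f i + g i) = ulim f + ulim g.
Proof.
move=> hf hg; rewrite /ulim limD//.
- exact: ultra_bounded_cvg hf.
- exact: ultra_bounded_cvg hg.
Qed.

Lemma ulimZ c (f : I -> R) M : (forall i, `|f i| <= M) ->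
  ulim (fun i => c * f i) = c * ulim f.
Proof. by move=> hf; rewrite /ulim limZr//; exact: ultra_bounded_cvg hf. Qed.

Lemma ulim_sum (J : Type) (s : seq J) (f : J -> I -> R) M :
  (forall j i, `|f j i| <= M) ->
  ulim (fun i => \sum_(j <- s) f j i) = \sum_(j <- s) ulim (f j).
Proof.
move=> hf; elim: s => [|j s IH].
  by under eq_fun do rewrite big_nil; rewrite ulim_cst big_nil.
under eq_fun do rewrite big_cons; rewrite big_cons -IH.
apply: (@ulimD _ _ (`|M| + \sum_(j <- s) `|M|)) => i.
  by rewrite (le_trans (hf j i))// (le_trans (ler_norm _))// lerDl sumr_ge0.
rewrite (le_trans (ler_norm_sum _ _ _))// -[leLHS]add0r lerD//.
by apply: ler_sum => k _; rewrite (le_trans (hf k i))// ler_norm.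
Qed.

(** Monotone and finitely additive on Borel sets, but in general not countably
    additive: mass may escape to the boundary of a set. *)
Definition limit_mass (A : set V) : R := ulim (fun i => fine (mu i A)).

Lemma fine_prob_bound (A : set B) i : measurable A -> `|fine (mu i A)| <= 1.
Proof.
move=> mA; rewrite ger0_norm ?fine_ge0//.
by rewrite -lee_fin fineK ?fin_num_measure// probability_le1.
Qed.

Lemma limit_mass_ge0 (A : set B) : measurable A -> 0 <= limit_mass A.
Proof.
move=> mA; rewrite -[leLHS]ulim_cst; apply: (@ulim_le _ _ 1) => i.
- by rewrite normr0.
- exact: fine_prob_bound.
- exact: fine_ge0.
Qed.

Lemma limit_mass_setT : limit_mass setT = 1.
Proof.
rewrite /limit_mass; under eq_fun do rewrite (probability_setT (mu _)).
exact: ulim_cst.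
Qed.

Lemma limit_mass_le_sum (A : set B) N (U : nat -> set B) : measurable A ->
  (forall n, measurable (U n)) ->
  (forall i, (mu i A <= \sum_(n < N) mu i (U n))%E) ->
  limit_mass A <= \sum_(n < N) limit_mass (U n).
Proof.
move=> mA mU h.
rewrite -(@ulim_sum _ _ _ 1) => [|n i]; last exact: fine_prob_bound.
have bU n i : `|fine (mu i (U n))| <= 1 by exact: fine_prob_bound.
apply: (@ulim_le _ _ (1 + N%:R)) => i.
- by rewrite (le_trans (fine_prob_bound _ mA))// lerDl.
- rewrite (le_trans (ler_norm_sum _ _ _))//.
  rewrite (@le_trans _ _ (\sum_(n < N) 1)) ?ler_sum//.
  by rewrite sumr_const card_ord lerDr.
- rewrite -lee_fin -sumEFin fineK ?fin_num_measure//.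
  rewrite (le_trans (h i))//; apply: lee_sum => n _.
  by rewrite fineK ?fin_num_measure.
Qed.

Lemma limit_mass_le (A C : set B) : measurable A -> measurable C -> A `<=` C ->
  limit_mass A <= limit_mass C.
Proof.
move=> mA mC AC.
have := @limit_mass_le_sum A 1 (fun=> C) mA (fun=> mC); rewrite big_ord1;
  apply => i.
by rewrite big_ord1 le_measure ?inE.
Qed.

Lemma limit_mass_add_le (A C D : set B) : measurable A -> measurable C ->
  measurable D -> A `&` C = set0 -> A `|` C `<=` D ->
    limit_mass A + limit_mass C <= limit_mass D.
Proof.
move=> mA mC mD AC0 ACD.
have bA := fun i => @fine_prob_bound A i mA.
have bC := fun i => @fine_prob_bound C i mC.
rewrite /limit_mass -(@ulimD _ _ 1)//; apply: (@ulim_le _ _ 2) => i.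
- by rewrite (le_trans (ler_normD _ _))// (_ : 2 = 1 + 1) ?lerD.
- by rewrite (le_trans (fine_prob_bound _ mD))// ler1n.
- rewrite -lee_fin EFinD !fineK ?fin_num_measure//.
  by rewrite -measureU// le_measure ?inE//; exact: measurableU.
Qed.

Definition deep (U : set V) (r : R) : set V := [set x | ball x r `<=` U].

Lemma deep_sub U r : 0 < r -> deep U r `<=` U.
Proof. by move=> r0 x; apply; exact: ballxx. Qed.

Lemma le_deep U W r s : U `<=` W -> s <= r -> deep U r `<=` deep W s.
Proof.
by move=> UW sr x dx; apply: subset_trans UW; apply: subset_trans dx;
  exact: le_ball.
Qed.

Lemma deep_closed U r : closed (deep U r).
Proof.
rewrite -openC.
have -> : ~` deep U r = \bigcup_(y in ~` U) ball y r.
  apply/seteqP; split=> [x|x [y nUy xy] h].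
    by move=> /existsNP[y /not_implyP[xy nUy]]; exists y => //; exact: ball_sym.
  by apply/nUy/h/ball_sym.
apply: bigcup_open => y _; have [r0|r0] := ltP 0 r; first exact: ball_open.
rewrite (_ : ball y r = set0); first exact: open0.
by apply/seteqP; split=> // z [] /lt_le_trans /(_ r0); rewrite ltxx.
Qed.

Lemma deep_measurable U r : measurable (deep U r : set B).
Proof. by apply: closed_measurable_rV; exact: deep_closed. Qed.

(** The inner regularization of the limit: mass at positive distance from the
    complement of U cannot leave U in the limit. *)
Definition inner_mass (U : set V) : R :=
  sup [set limit_mass (deep U r) | r in [set r | 0 < r]].

Let inner_mass_ub U : ubound [set limit_mass (deep U r) | r in [set r | 0 < r]] 1.
Proof.
move=> _ [r r0 <-]; rewrite -limit_mass_setT; apply: limit_mass_le => //.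
exact: deep_measurable.
Qed.

Let inner_mass_has_sup U :
  has_sup [set limit_mass (deep U r) | r in [set r | 0 < r]].
Proof.
split; last by exists 1; exact: inner_mass_ub.
by exists (limit_mass (deep U 1)), 1 => //=; rewrite ltr01.
Qed.

Lemma limit_mass_deep_le U r : 0 < r -> limit_mass (deep U r) <= inner_mass U.
Proof. by move=> r0; apply: (ub_le_sup (inner_mass_has_sup U).2); exists r. Qed.

Lemma inner_mass_le U M : (forall r, 0 < r -> limit_mass (deep U r) <= M) ->
  inner_mass U <= M.
Proof.
move=> h; apply: ge_sup; first exact: (inner_mass_has_sup U).1.
by move=> _ [r r0 <-]; exact: h.
Qed.

Lemma inner_mass_ge0 U : 0 <= inner_mass U.
Proof.
apply: (@le_trans _ _ (limit_mass (deep U 1))); last exact: limit_mass_deep_le.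
by apply: limit_mass_ge0; exact: deep_measurable.
Qed.

Lemma inner_mass_mono U W : U `<=` W -> inner_mass U <= inner_mass W.
Proof.
move=> UW; apply: inner_mass_le => r r0; apply: le_trans (limit_mass_deep_le _ r0).
by apply: limit_mass_le; [exact: deep_measurable..|exact: le_deep].
Qed.

Lemma inner_mass_le_limit_mass U : open U -> inner_mass U <= limit_mass U.
Proof.
move=> oU; apply: inner_mass_le => r r0; apply: limit_mass_le.
- exact: deep_measurable.
- exact: open_measurable_rV.
- exact: deep_sub.
Qed.

Lemma inner_mass_setT : inner_mass setT = 1.
Proof.
apply/eqP; rewrite eq_le; apply/andP; split.
  by rewrite -limit_mass_setT; apply: inner_mass_le_limit_mass; exact: openT.
apply: le_trans (limit_mass_deep_le setT ltr01).
rewrite (_ : deep setT 1 = setT) ?limit_mass_setT//.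
by apply/seteqP; split.
Qed.

Lemma inner_mass_set0 : inner_mass set0 = 0.
Proof.
apply/eqP; rewrite eq_le inner_mass_ge0 andbT.
rewrite (le_trans (inner_mass_le_limit_mass open0))// /limit_mass.
by under eq_fun do rewrite measure0; rewrite ulim_cst.
Qed.

Variables (K : set V) (cK : compact K) (muK : forall i, mu i (~` K) = 0%E).

Lemma compact_measurable_rV (C : set V) : compact C -> measurable (C : set B).
Proof.
by move=> cC; apply: closed_measurable_rV; exact: compact_closed.
Qed.

(** By compactness of K, finitely many U n suffice, and each point is deep in
    one of them, at a depth that does not depend on the point.  This is where
    countable subadditivity comes from. *)
Lemma deep_compact_cover (U : nat -> set V) r : (forall n, open (U n)) -> 0 < r ->
  exists N, K `&` deep (\bigcup_n U n) r `<=`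
    \big[setU/set0]_(n < N) deep (U n) N.+1%:R^-1.
Proof.
move=> oU r0.
have cC : compact (K `&` deep (\bigcup_n U n) r).
  by apply: compact_closedI => //; exact: deep_closed.
pose Q N x := exists2 n, (n < N)%N & deep (U n) N.+1%:R^-1 x.
have /compact_near_coveringP/(_ nat \oo Q _) := cC.
case=> [x [_ /deep_sub-/(_ r0) [n _ Unx]]|N _ hN].
  have /nbhs_ballP[e /= e0 he] : nbhs x (U n) by exact: open_nbhs_nbhs.
  have e20 : 0 < e / 2 by rewrite divr_gt0.
  exists (ball x (e / 2), [set N | (n < N)%N /\ N.+1%:R^-1 < e / 2]).
    split; first exact: nbhsx_ballx.
    apply: filterI; first exact: nbhs_infty_gt.
    exact: (near_infty_natSinv_lt (PosNum e20)).
  move=> [x' N]/= [xx' [nN Ne]]; exists n => //.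
  apply: subset_trans he => y x'y; rewrite (splitr e).
  by apply: (ball_triangle xx'); apply: le_ball x'y; exact: ltW.
exists N => x /(hN N (leqnn N))[n nN dn].
by rewrite -(bigcup_mkord N (fun n => deep (U n) N.+1%:R^-1)); exists n.
Qed.

(** As the probabilities live on K, the finite cover of the part of the union
    inside K controls the whole mass. *)
Lemma limit_mass_deep_bigcup (U : nat -> set V) r : (forall n, open (U n)) ->
  0 < r ->
  exists N, limit_mass (deep (\bigcup_n U n) r) <= \sum_(n < N) inner_mass (U n).
Proof.
move=> oU r0; have [N hN] := deep_compact_cover oU r0; exists N.
have N0 : 0 < N.+1%:R^-1 :> R by rewrite invr_gt0.
have mD n : measurable (deep (U n) N.+1%:R^-1 : set B) by exact: deep_measurable.
have mK := compact_measurable_rV cK; have mKC := measurableC mK.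
apply: (@le_trans _ _ (\sum_(n < N) limit_mass (deep (U n) N.+1%:R^-1)));
  last first.
  by apply: ler_sum => n _; exact: limit_mass_deep_le.
have mA := deep_measurable (\bigcup_n U n) r.
apply: (@limit_mass_le_sum _ N (fun n => deep (U n) N.+1%:R^-1)) => // i.
rewrite -(setIT (deep _ r)) -(setUv K) setIUr.
have h0 : mu i (deep (\bigcup_n U n) r `&` ~` K) = 0%E.
  by apply: subset_measure0 (muK i) => //;
    (exact: subIsetr || exact: measurableI mA mKC).
rewrite measureU//; last 3 first.
- exact: measurableI.
- by apply: measurableI => //; exact: measurableC.
- by rewrite setIACA setICr setI0.
rewrite [X in (_ + X)%E]h0 adde0 setIC.
apply: le_trans (_ : _ <= mu i (\big[setU/set0]_(n < N) deep (U n) N.+1%:R^-1))%E _.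
  rewrite le_measure ?inE//; first exact: measurableI.
  by apply: bigsetU_measurable => n _.
by apply: (@Boole_inequality _ _ _ (mu i) (fun n => deep (U n) N.+1%:R^-1)) => n _.
Qed.

Local Open Scope ereal_scope.

(** The outer measure of the Riesz construction, with the limit mass in place of
    a linear functional. *)
Definition wlim_outer (E : set V) : \bar R :=
  ereal_inf [set (inner_mass U)%:E | U in [set U | open U /\ E `<=` U]].

Lemma wlim_outer_le E U : open U -> E `<=` U -> wlim_outer E <= (inner_mass U)%:E.
Proof. by move=> oU EU; apply: ereal_inf_lbound; exists U. Qed.

Lemma wlim_outer_ge E M :
  (forall U, open U -> E `<=` U -> M <= (inner_mass U)%:E) -> M <= wlim_outer E.
Proof. by move=> h; apply: le_ereal_inf_tmp => _ [U [oU EU] <-]; exact: h. Qed.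

Let wlim_outer_ge0 E : 0 <= wlim_outer E.
Proof. by apply: wlim_outer_ge => U _ _; rewrite lee_fin inner_mass_ge0. Qed.

Let wlim_outer0 : wlim_outer set0 = 0.
Proof.
apply/eqP; rewrite eq_le wlim_outer_ge0 andbT.
by have := wlim_outer_le open0 (@subset_refl _ set0); rewrite inner_mass_set0.
Qed.

Let wlim_outer_mono : {homo wlim_outer : A C / A `<=` C >-> A <= C}.
Proof.
move=> A C AC; apply: wlim_outer_ge => U oU CU.
by apply: wlim_outer_le => //; exact: subset_trans CU.
Qed.

Let wlim_outer_fin E : wlim_outer E \is a fin_num.
Proof.
rewrite ge0_fin_numE//; apply: (@le_lt_trans _ _ 1); last exact: ltry.
by rewrite -inner_mass_setT; apply: wlim_outer_le => //; exact: openT.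
Qed.

Let inner_mass_bigcup (U : nat -> set V) : (forall n, open (U n)) ->
  (inner_mass (\bigcup_n U n))%:E <= \sum_(0 <= n <oo) (inner_mass (U n))%:E.
Proof.
move=> oU; have n0 n : 0 <= (inner_mass (U n))%:E by rewrite lee_fin inner_mass_ge0.
have [->|hfin] := eqVneq (\sum_(0 <= n <oo) (inner_mass (U n))%:E) +oo.
  exact: leey.
have s0 : 0 <= \sum_(0 <= n <oo) (inner_mass (U n))%:E by exact: nneseries_ge0.
have sfin : \sum_(0 <= n <oo) (inner_mass (U n))%:E \is a fin_num.
  by rewrite ge0_fin_numE// lt_neqAle hfin leey.
rewrite -(fineK sfin) lee_fin; apply: inner_mass_le => r r0.
have [N hN] := limit_mass_deep_bigcup oU r0.
rewrite -lee_fin fineK//.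
apply: (@le_trans _ _ (\sum_(n < N) inner_mass (U n))%:E); first by rewrite lee_fin.
rewrite -sumEFin -(big_mkord xpredT (fun n => (inner_mass (U n))%:E)).
by apply: nneseries_lim_ge => n _ _.
Qed.

Let wlim_outer_sigma_subadd : sigma_subadditive wlim_outer.
Proof.
move=> E; apply/lee_addgt0Pr => e e0.
have h n : exists U, [/\ open U, E n `<=` U &
    (inner_mass U)%:E <= wlim_outer (E n) + (e / (2 ^ n.+1)%:R)%:E].
  have en : (0 < e / (2 ^ n.+1)%:R)%R by rewrite divr_gt0// ltr0n expn_gt0.
  have [_ [U [oU EU] <-] /ltW hU] :=
    lb_ereal_inf_adherent en (wlim_outer_fin (E n)).
  by exists U.
have [U hU] := choice h.
apply: (@le_trans _ _ (inner_mass (\bigcup_n U n))%:E).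
  apply: wlim_outer_le.
    by apply: bigcup_open => n _; have [] := hU n.
  by apply: subset_bigcup => n _; have [] := hU n.
apply: le_trans (inner_mass_bigcup _) _.
  by move=> n; have [] := hU n.
apply: le_trans (epsilon_trick xpredT _ (ltW e0)) => //.
apply: lee_nneseries => [n _|n _]; first by rewrite lee_fin inner_mass_ge0.
by have [] := hU n.
Qed.

HB.instance Definition _ := isOuterMeasure.Build R V wlim_outer
  wlim_outer0 wlim_outer_ge0 wlim_outer_mono wlim_outer_sigma_subadd.

(** A deep part of the intersection of U and G, and a deep part of what remains
    of U, are disjoint and both deep in U; so their limit masses add up to at
    most the inner mass of U. *)
Lemma open_caratheodory (G : set V) : open G -> wlim_outer.-caratheodory G.
Proof.
move=> oG; apply: le_caratheodory_measurable => X.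
apply: wlim_outer_ge => U oU XU.
apply: (@le_trans _ _ (wlim_outer (U `&` G) + wlim_outer (U `&` ~` G))).
  by apply: leeD; apply: wlim_outer_mono; exact: setSI.
have oUG := openI oU oG.
set w := wlim_outer (U `&` ~` G).
have wfin : w \is a fin_num by exact: wlim_outer_fin.
apply: (@le_trans _ _ ((inner_mass (U `&` G))%:E + w)).
  by apply: leeD => //; exact: wlim_outer_le.
rewrite -leeBrDr// -(fineK wfin) -EFinB lee_fin; apply: inner_mass_le => r r0.
rewrite lerBrDr -lerBrDl -lee_fin fineK//.
(* W contains the part of U outside G, and is disjoint from the deep part. *)
pose W := U `&` ~` deep (U `&` G) r.
have oW : open W by apply: openI => //; rewrite openC; exact: deep_closed.
apply: (@le_trans _ _ (inner_mass W)%:E).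
  apply: wlim_outer_le => // x [Ux nGx]; split=> // /deep_sub-/(_ r0)[].
  by move=> _ /nGx.
rewrite lee_fin; apply: inner_mass_le => s s0; rewrite lerBrDl.
have m0 : (0 < Num.min r s)%R by rewrite lt_min r0.
apply: le_trans (limit_mass_deep_le U m0); apply: limit_mass_add_le;
  try exact: deep_measurable.
  by apply/seteqP; split=> // x [dx /deep_sub-/(_ s0)[_]].
move=> x [|]; apply: le_deep.
- exact: subIsetl.
- by rewrite ge_min lexx.
- exact: subIsetl.
- by rewrite ge_min lexx orbT.
Qed.

Lemma borel_caratheodory (A : set B) : measurable A ->
  wlim_outer.-caratheodory A.
Proof.
move: A; apply: smallest_sub; last exact: open_caratheodory.
split.
- exact: caratheodory_measurable_set0.
- by move=> A cA; rewrite setTD; exact: caratheodory_measurable_setC.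
- by move=> A cA; exact: caratheodory_measurable_bigcup.
Qed.

Definition wlim_measure : set B -> \bar R := wlim_outer.

Let wlim_measure_sigma_additive : semi_sigma_additive wlim_measure.
Proof.
move=> A mA tA mUA; apply: (@caratheodory_measure_sigma_additive _ _ wlim_outer)
  => //.
- by move=> n; exact: borel_caratheodory.
- exact: borel_caratheodory.
Qed.

HB.instance Definition _ := isMeasure.Build _ B R wlim_measure
  wlim_outer0 wlim_outer_ge0 wlim_measure_sigma_additive.

Let wlim_measureT : wlim_measure setT = 1.
Proof.
rewrite -inner_mass_setT; apply/eqP; rewrite eq_le; apply/andP; split.
  by apply: wlim_outer_le => //; exact: openT.
by apply: wlim_outer_ge => U _ TU; rewrite lee_fin inner_mass_mono.
Qed.

HB.instance Definition _ := Measure_isProbability.Build _ B R wlim_measure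
  wlim_measureT.

(** The half of the portmanteau theorem that the construction gives directly; the
    rest follows from it, see [Rintegral_wlim]. *)
Lemma weak_limit_exists : exists nu : probability B R,
  forall U : set V, open U -> nu U <= (limit_mass U)%:E.
Proof.
exists (wlim_measure : probability B R) => U oU.
apply: (@le_trans _ _ (inner_mass U)%:E); first exact: wlim_outer_le.
by rewrite lee_fin inner_mass_le_limit_mass.
Qed.

End weak_limit.

Lemma count_lt_le (R : realType) (y : R) N : 0 <= y ->
  \sum_(k < N) ((k.+1%:R < y)%R : nat)%:R <= y :> R.
Proof.
move=> y0; elim: N => [|N IH]; first by rewrite big_ord0.
rewrite big_ord_recr/=; have [Ny|] := ltP N.+1%:R y; last by rewrite addr0.
apply: le_trans (ltW Ny); rewrite -natr1 lerD2r.
apply: (@le_trans _ _ (\sum_(k < N) 1)); last by rewrite sumr_const card_ord.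
by apply: ler_sum => k _; case: (_ < _).
Qed.

Lemma le_count_lt (R : realType) (y : R) N : y <= N%:R ->
  y <= 1 + \sum_(k < N) ((k.+1%:R < y)%R : nat)%:R.
Proof.
elim: N => [|N IH] yN; first by rewrite big_ord0 addr0 (le_trans yN).
have [yN'|Ny] := leP y N%:R.
  by rewrite big_ord_recr/= addrA (le_trans (IH yN'))// lerDl.
apply: le_trans yN _; rewrite -nat1r lerD2l big_ord_recr/= -[leLHS]addr0 lerD//.
rewrite (eq_bigr (fun=> 1)) ?sumr_const ?card_ord// => k _.
by rewrite (le_lt_trans _ Ny)// ler_nat.
Qed.

Section weak_limit_integral.
Variables (R : realType) (d : nat) (I : Type) (F : set_system I).
Context {FU : UltraFilter F}.
Local Notation V := 'rV[R]_d.
Local Notation B := (borel_rV R d).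
Variables (mu : I -> probability B R) (nu : probability B R).
Hypothesis nu_le : forall U : set V, open U -> (nu U <= (limit_mass F mu U)%:E)%E.

Lemma bounded_meas_continuous (f : V -> R) M : continuous f ->
  (forall x, `|f x| <= M) -> bounded_meas (f : B -> R).
Proof.
move=> cf fM; split; first exact: continuous_measurable_rV.
by exists M.
Qed.

(** A function with values in [0, 1] is within 1/n of the average of the
    indicators of its superlevel sets at k/n, which are open. *)
Lemma Rintegral_wlim_le (f : V -> R) : continuous f ->
  (forall x, 0 <= f x <= 1) ->
  \int[nu]_x f x <= ulim F (fun i => \int[mu i]_x f x).
Proof.
move=> cf f01; have bf : bounded_meas (f : B -> R).
  apply: (@bounded_meas_continuous _ 1) => // x.
  by case/andP: (f01 x) => f0 f1; rewrite ger0_norm.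
have bI i : `|\int[mu i]_x f x| <= 1.
  apply: Rintegral_prob_bound => // x.
  by case/andP: (f01 x) => f0 f1; rewrite ger0_norm.
apply/ler_addgt0Pr => e e0.
have [N Ne] := inv_nat_lt e0.
set n := N.+1; have n0 : 0 < n%:R :> R by rewrite ltr0n.
pose A k : set V := [set x | k.+1%:R < n%:R * f x].
have oA k : open (A k).
  have -> : A k = (fun x => n%:R * f x) @^-1` [set y | k.+1%:R < y] by [].
  apply: open_comp; last exact: open_gt.
  by move=> x _; exact: (continuousM (@cst_continuous _ _ (n%:R : R) x) (cf x)).
have mA k : measurable (A k : set B) := open_measurable_rV (oA k).
pose s (x : B) : R := \sum_(k < n) \1_(A k) x.
have sE x : s x = \sum_(k < n) ((k.+1%:R < n%:R * f x)%R : nat)%:R.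
  apply: eq_bigr => k _; rewrite indicE; congr (_ _)%:R.
  by apply/idP/idP; rewrite inE.
have bs : bounded_meas s by apply: bounded_meas_sum => k; exact: bounded_meas_indic.
have Is (P : probability B R) : \int[P]_x s x = \sum_(k < n) fine (P (A k)).
  rewrite Rintegral_bounded_meas_sum; last by move=> k; exact: bounded_meas_indic.
  by apply: eq_bigr => k _; rewrite Rintegral_prob_indic.
have h1 x : n%:R * f x <= 1 + s x.
  rewrite sE; apply: le_count_lt; rewrite -[leRHS]mulr1 ler_pM2l//.
  by case/andP: (f01 x).
have h2 x : s x <= n%:R * f x.
  by rewrite sE; apply: count_lt_le; rewrite mulr_ge0//; case/andP: (f01 x).
have bnf : bounded_meas (fun x : B => n%:R * f x).
  by apply: bounded_measM => //; exact: bounded_meas_cst.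
have step : n%:R * \int[nu]_x f x <= 1 + n%:R * ulim F (fun i => \int[mu i]_x f x).
  rewrite -Rintegral_bounded_measZ//.
  apply: (@le_trans _ _ (\int[nu]_x (1 + s x))).
    by apply: Rintegral_bounded_meas_le => //; apply: bounded_measD => //;
      exact: bounded_meas_cst.
  rewrite Rintegral_bounded_measD//; last exact: bounded_meas_cst.
  rewrite Rintegral_prob_cst lerD2l Is.
  apply: (@le_trans _ _ (\sum_(k < n) limit_mass F mu (A k))).
    apply: ler_sum => k _; rewrite -lee_fin fineK ?nu_le//.
    exact: fin_num_measure.
  rewrite -(@ulimZ _ _ _ _ _ _ 1)// /limit_mass -(@ulim_sum _ _ _ _ _ _ _ 1);
    last first.
    by move=> k i; exact: fine_prob_bound.
  apply: (@ulim_le _ _ _ _ _ _ n%:R) => i.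
  - rewrite (le_trans (ler_norm_sum _ _ _))//.
    apply: (@le_trans _ _ (\sum_(k < n) 1)); last by rewrite sumr_const card_ord.
    by apply: ler_sum => k _; exact: fine_prob_bound.
  - by rewrite normrM normr_nat ler_piMr.
  - by rewrite -Is -Rintegral_bounded_measZ//; exact: Rintegral_bounded_meas_le.
rewrite -(ler_pM2l n0) (le_trans step)// mulrDr addrC lerD2l.
by rewrite -ler_pdivrMl// mulr1 ltW.
Qed.

Lemma Rintegral_wlim (f : V -> R) : continuous f -> (forall x, `|f x| <= 1) ->
  \int[nu]_x f x = ulim F (fun i => \int[mu i]_x f x).
Proof.
move=> cf f1.
have bf : bounded_meas (f : B -> R) by exact: bounded_meas_continuous f1.
(* For c = 1 and c = -1 the function (1 + c f)/2 has values in [0, 1], which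
   turns the inequality into an equality. *)
have half c : `|c| = 1 ->
    c * \int[nu]_x f x <= c * ulim F (fun i => \int[mu i]_x f x).
  move=> c1; pose g x := 2^-1 * (1 + c * f x).
  have Ig (P : probability B R) : \int[P]_x g x = 2^-1 * (1 + c * \int[P]_x f x).
    have bc := bounded_measM (bounded_meas_cst _ c) bf.
    rewrite Rintegral_bounded_measZ; last by apply: bounded_measD => //;
      exact: bounded_meas_cst.
    rewrite Rintegral_bounded_measD//; last exact: bounded_meas_cst.
    by rewrite Rintegral_prob_cst Rintegral_bounded_measZ.
  have bI i : `|\int[mu i]_x f x| <= 1 by exact: Rintegral_prob_bound.
  have : \int[nu]_x g x <= ulim F (fun i => \int[mu i]_x g x).
    apply: Rintegral_wlim_le => [x|x].
      have cc := continuousM (@cst_continuous _ _ c x) (cf x).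
      have c1c := continuousD (@cst_continuous _ _ (1 : R) x) cc.
      exact: (continuousM (@cst_continuous _ _ (2^-1 : R) x) c1c).
    have : `|c * f x| <= 1 by rewrite normrM c1 mul1r.
    rewrite ler_norml /g => /andP[]; lra.
  rewrite Ig (_ : (fun i => \int[mu i]_x g x) =
    (fun i => 2^-1 * (1 + c * \int[mu i]_x f x))); last by apply/funext => i;
      exact: Ig.
  have bc i : `|c * \int[mu i]_x f x| <= 1 by rewrite normrM c1 mul1r.
  rewrite (@ulimZ _ _ _ _ _ _ 2); last first.
    move=> i; rewrite (le_trans (ler_normD _ _))// normr1.
    by rewrite (_ : 2 = 1 + 1)// lerD2l.
  rewrite (@ulimD _ _ _ _ _ _ 1)//; last by move=> i; rewrite normr1.
  rewrite ulim_cst (@ulimZ _ _ _ _ _ _ 1)//; lra.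
apply/eqP; rewrite eq_le; apply/andP; split.
  by have := half 1 (normr1 _); rewrite !mul1r.
by have := half (-1); rewrite normrN1 => /(_ erefl); rewrite !mulN1r lerN2.
Qed.

End weak_limit_integral.

(** * The Vietoris topology on compact subsets of the cube *)

Section vietoris.
Variable X : topologicalType.

Lemma vietoris_subbase_open (W : set (hyperspace X)) :
  vietoris_subbase W -> open W.
Proof.
move=> sW; exists [set W]; last by rewrite bigcup_set1.
by move=> _ ->; exact: (finI_from1 _ sW).
Qed.

Lemma open_miss (C : set X) : closed C ->
  open [set A : hyperspace X | hset A `&` C = set0].
Proof. by move=> cC; apply: vietoris_subbase_open; left; exists C. Qed.

(** Finite intersections of the two kinds of subbasic sets form a base, so only
    these two kinds of preimages have to be examined. *)
Lemma continuous_hyperspace (Y : topologicalType) (f : Y -> hyperspace X) :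
  (forall C, closed C -> open [set y | hset (f y) `&` C = set0]) ->
  (forall U, open U -> open [set y | hset (f y) `&` U !=set0]) ->
  continuous f.
Proof.
move=> hC hU; apply/continuousP => W oW.
have [D sD <-] : exists2 D, D `<=` finI_from (@vietoris_subbase X) id &
    \bigcup_(V in D) V = W by exact: oW.
rewrite preimage_bigcup; apply: bigcup_open => V /sD [s sV <-].
rewrite preimage_bigcap openE => y hy; apply: filter_bigI => i si.
apply: open_nbhs_nbhs; split; last exact: hy.
by case/set_mem: (sV _ si) => [[C cC <-]|[U oU <-]]; [exact: hC|exact: hU].
Qed.

End vietoris.

Section cube.
Variables (R : realType) (d : nat).
Local Notation V := 'rV[R]_d.

Lemma unit_cube_compact : compact (@unit_cube R d).
Proof.
have -> : @unit_cube R d = [set v : V | forall i, `[0, 1]%classic (v ord0 i)].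
  by apply/seteqP; split=> v h i; have := h i; rewrite /= in_itv.
by apply: (@rV_compact (R : ptopologicalType) d (fun=> `[0, 1]%classic)) => i;
  exact: segment_compact.
Qed.

Lemma set_val_continuous : continuous (set_val : set_type (@unit_cube R d) -> V).
Proof. exact: initial_continuous. Qed.

Lemma ambient_compact (A : K_cube R d) : compact (ambient A).
Proof.
apply: (@continuous_compact _ _ (set_val : set_type (@unit_cube R d) -> V)).
  exact/continuous_subspaceT/set_val_continuous.
exact: hset_compact.
Qed.

Lemma ambient_closed (A : K_cube R d) : closed (ambient A).
Proof. by apply: compact_closed => //; exact: ambient_compact. Qed.

Lemma ambient_cube (A : K_cube R d) : ambient A `<=` @unit_cube R d.
Proof. by move=> _ [x _ <-]; exact: set_valP. Qed.

Lemma open_ambient_sub (U : set V) : open U ->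
  open [set A : K_cube R d | ambient A `<=` U].
Proof.
move=> oU.
have cC : closed (set_val @^-1` (~` U) : set (set_type (@unit_cube R d))).
  apply: closed_comp => [x _|]; first exact: set_val_continuous.
  exact: open_closedC.
have := open_miss cC; congr open; apply/seteqP; split=> A /=.
  move=> h _ [x Ax <-]; apply: contrapT => nU.
  by have : (hset A `&` set_val @^-1` (~` U)) x by []; rewrite h.
move=> h; apply/seteqP; split=> // x [Ax] /=; apply.
by apply: h; exists x.
Qed.

End cube.

(** * Fourier decay is a closed condition *)

Section fourier_closed.
Variables (R : realType) (d : nat).
Local Notation V := 'rV[R]_d.
Local Notation B := (borel_rV R d).

Definition ft_decay (mu : probability B R) (c s : R) :=
  forall x : V, x != 0 ->
    Normc.normc (fourier_transform mu x) <= c * enorm x `^ (- s / 2).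

Lemma dotp_continuous (xi : V) : continuous (dotp xi).
Proof.
rewrite /dotp; elim: (index_enum _) => [|i s IH].
  by under eq_fun do rewrite big_nil; exact: cst_continuous.
under eq_fun do rewrite big_cons; move=> x.
have ci := continuousM (@cst_continuous _ _ (xi ord0 i : R) x)
  (@coord_continuous_rV R d i x).
exact: (continuousD ci (IH x)).
Qed.

Lemma phase_continuous (xi : V) : continuous (fun x : V => - dotp xi x).
Proof. by move=> x; exact: (continuousN (@dotp_continuous xi x)). Qed.

Lemma cos_phase_continuous (xi : V) : continuous (fun x : V => cos (- dotp xi x)).
Proof.
by move=> x; apply: (continuous_comp (@phase_continuous xi x));
  exact: continuous_cos.
Qed.

Lemma sin_phase_continuous (xi : V) : continuous (fun x : V => sin (- dotp xi x)).
Proof.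
by move=> x; apply: (continuous_comp (@phase_continuous xi x));
  exact: continuous_sin.
Qed.

Lemma norm_cos_le1 (t : R) : `|cos t| <= 1.
Proof. by rewrite ler_norml cos_geN1 cos_le1. Qed.

Lemma norm_sin_le1 (t : R) : `|sin t| <= 1.
Proof. by rewrite ler_norml sin_geN1 sin_le1. Qed.

Lemma normc_le (a b c : R) : 0 <= c ->
  (Normc.normc (Complex a b) <= c) = (a ^+ 2 + b ^+ 2 <= c ^+ 2).
Proof.
by move=> c0; rewrite /Normc.normc -{1}(ger0_norm c0) -sqrtr_sqr ler_sqrt// sqr_ge0.
Qed.

Lemma unit_cube_closed : closed (@unit_cube R d).
Proof. by apply: compact_closed => //; exact: unit_cube_compact. Qed.

Definition decay_set (c s : R) : set (K_cube R d) :=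
  [set A | exists mu : probability B R,
    msupport mu `<=` ambient A /\ ft_decay mu c s].

(** Weak compactness of the probabilities on the cube: the witnesses for sets
    converging to A have a weak limit, which is a witness for A. *)
Lemma decay_set_closed (c s : R) : 0 <= c -> closed (decay_set c s).
Proof.
move=> c0 A clA.
have PF : ProperFilter (within (decay_set c s) (nbhs A)).
  exact: within_nbhs_proper.
have [F [FU subF]] := ultraFilterLemma PF.
have FF : Filter F by have PFF : ProperFilter F := ultra_proper;
  exact: filter_filter.
have Fin : F (decay_set c s).
  by apply: subF; rewrite /within/=; exact: filterE.
have Fnear W : nbhs A W -> F W.
  by move=> AW; apply: subF; rewrite /within/=; apply: filterS AW.
(* The Dirac mass at 0 is a default value off the set, so that the limit mass is
   defined from probabilities on the cube at every index. *)
have muex (E : K_cube R d) : exists mu : probability B R,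
    mu (~` @unit_cube R d) = 0%E /\ (decay_set c s E ->
      msupport mu `<=` ambient E /\ ft_decay mu c s).
  have [[mu [smu dmu]]|nE] := pselect (decay_set c s E).
    exists mu; split=> //; apply: msupport_null; first exact: unit_cube_closed.
    by apply: subset_trans smu _; exact: ambient_cube.
  exists (dirac (0 : B) : probability B R); split=> //.
  rewrite /= /dirac indicE memNset//= => h; apply: h => i.
  by rewrite mxE lexx ler01.
have [mu hmu] := choice muex.
have mu0 E : mu E (~` @unit_cube R d) = 0%E by have [] := hmu E.
have [nu hnu] := weak_limit_exists (F := F) (@unit_cube_compact R d) mu0.
exists nu; split.
  move=> x sx; apply: contrapT => nAx.
  have oA : open (~` ambient A) by rewrite openC; exact: ambient_closed.
  have /nbhs_ballP[e /= e0 he] : nbhs x (~` ambient A) by exact: open_nbhs_nbhs.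
  have e20 : 0 < e / 2 by rewrite divr_gt0.
  (* Sets near A avoid the closed set C, and C contains the ball of radius e/2
     around x, so this ball is eventually null. *)
  pose C := deep (~` ambient A) (e / 2).
  have hA : nbhs A [set E : K_cube R d | ambient E `<=` ~` C].
    apply: open_nbhs_nbhs; split.
      by apply: open_ambient_sub; rewrite openC; exact: deep_closed.
    by move=> y Ay /(deep_sub e20).
  have lam0 : limit_mass F mu (ball x (e / 2)) = 0.
    rewrite /limit_mass /ulim; apply: lim_near_cst => //.
    have FE : F (decay_set c s `&` [set E | ambient E `<=` ~` C]).
      exact: filterI Fin (Fnear _ hA).
    apply: (@filterS _ F _ _ _ _ FE) => E [dE EC].
    have [_ /(_ dE) [smu _]] := hmu E.
    rewrite (_ : mu E (ball x (e / 2)) = 0%E)//.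
    apply: subset_measure0 (msupport_null (@ambient_closed _ _ E) smu) => //.
    - by apply: open_measurable_rV; exact: ball_open.
    - apply: open_measurable_rV; rewrite openC; exact: ambient_closed.
    move=> y xy Ey; apply: (EC y Ey) => z yz; apply: he.
    by rewrite (splitr e); exact: ball_triangle xy yz.
  have oB : open (ball x (e / 2)) by exact: ball_open.
  have := hnu _ oB; rewrite lam0 leNgt.
  by rewrite sx//; split => //; exact: ballxx.
move=> xi xi0; rewrite normc_le; last by rewrite mulr_ge0// powR_ge0.
have hc := @cos_phase_continuous xi; have hs := @sin_phase_continuous xi.
have c1 x := norm_cos_le1 (- dotp xi x); have s1 x := norm_sin_le1 (- dotp xi x).
rewrite /= (Rintegral_wlim hnu hc c1) (Rintegral_wlim hnu hs s1).
set a := fun i => _; set b := fun i => _.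
have ab : cvg (a i @[i --> F]).
  apply: (@ultra_bounded_cvg _ _ _ _ 1) => E.
  apply: Rintegral_prob_bound => //; exact: bounded_meas_continuous.
have bb : cvg (b i @[i --> F]).
  apply: (@ultra_bounded_cvg _ _ _ _ 1) => E.
  apply: Rintegral_prob_bound => //; exact: bounded_meas_continuous.
have abcvg : a i * a i + b i * b i @[i --> F] -->
    ulim F a * ulim F a + ulim F b * ulim F b.
  exact: cvgD (cvgM ab ab) (cvgM bb bb).
rewrite !expr2 -(cvg_lim _ abcvg)//; apply: limr_le.
  by apply/cvg_ex; eexists; exact: abcvg.
apply: (@filterS _ F _ _ _ _ Fin) => E dE; have [_ /(_ dE) [_ /(_ xi xi0)]] :=
  hmu E.
by rewrite normc_le ?mulr_ge0 ?powR_ge0.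
Qed.

End fourier_closed.

(** * Hausdorff measures and open covers *)

Section hausdorff.
Variables (R : realType) (d : nat).
Local Notation V := 'rV[R]_d.
Implicit Types (x y : V) (U A : set V) (q s e : R).

Lemma dotpp_ge0 x : 0 <= dotp x x.
Proof. by apply: sumr_ge0 => i _; rewrite -expr2 sqr_ge0. Qed.

Lemma enorm_ge0 x : 0 <= enorm x. Proof. exact: sqrtr_ge0. Qed.

Lemma enorm_coord x i : `|x ord0 i| <= enorm x.
Proof.
rewrite -sqrtr_sqr ler_sqrt ?dotpp_ge0// /dotp (bigD1 i)//= expr2 lerDl.
by apply: sumr_ge0 => j _; rewrite -expr2 sqr_ge0.
Qed.

(** The price of passing to the sup norm, which is harmless below because only
    the vanishing of Hausdorff measures matters. *)
Lemma enorm_le x (M : R) : 0 <= M -> (forall i, `|x ord0 i| <= M) ->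
  enorm x <= Num.sqrt d%:R * M.
Proof.
move=> M0 h; rewrite -{1}(ger0_norm M0) -sqrtr_sqr -sqrtrM// ler_sqrt; last first.
  by rewrite mulr_ge0// sqr_ge0.
apply: (@le_trans _ _ (\sum_(i < d) M ^+ 2)); last first.
  by rewrite sumr_const card_ord mulr_natl.
by apply: ler_sum => i _; rewrite -expr2 -(real_normK (num_real _)) lerXn2r ?nnegrE.
Qed.

Lemma enorm0 : enorm (0 : V) = 0.
Proof. by rewrite /enorm /dotp big1 ?sqrtr0// => i _; rewrite mxE mulr0. Qed.

Local Open Scope ereal_scope.

Lemma ediam_ge U x y : U x -> U y -> (enorm (x - y)%R)%:E <= ediam U.
Proof. by move=> Ux Uy; apply: ereal_sup_ubound; exists (x, y). Qed.

Lemma ediam_le U (M : \bar R) :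
  (forall x y, U x -> U y -> (enorm (x - y)%R)%:E <= M) -> ediam U <= M.
Proof. by move=> h; apply: ge_ereal_sup => _ [[x y] [Ux Uy] <-]; exact: h. Qed.

Lemma ediam_ge0 U : U !=set0 -> 0 <= ediam U.
Proof.
by move=> [x Ux]; have := ediam_ge Ux Ux; rewrite subrr enorm0.
Qed.

Lemma diam_pow_ge0 s U : 0 <= diam_pow s U.
Proof. by rewrite /diam_pow; case: ifP => // _; exact: poweR_ge0. Qed.

Lemma diam_pow0 s : diam_pow s (set0 : set V) = 0.
Proof. by rewrite /diam_pow eqxx. Qed.

Lemma diam_pow_fin q U : (0 < q)%R -> U !=set0 -> diam_pow q U < +oo ->
  exists r : R,
    [/\ (0 <= r)%R, ediam U = r%:E & forall s, diam_pow s U = (r `^ s)%:E].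
Proof.
move=> q0 U0; have /negbTE Un0 : U != set0 by apply/set0P.
rewrite /diam_pow Un0; have := ediam_ge0 U0.
case: (ediam U) => [r r0 _|_|//]; last by rewrite poweRyr// gt_eqF.
by exists r; split=> // s; rewrite poweR_EFin.
Qed.

(** Covers without bound on the diameters: a small sum of positive powers forces
    small diameters, so nothing is lost, and open covers persist under small
    perturbations of a compact set. *)
Definition small_cover q e A := exists U : nat -> set V,
  [/\ forall k, open (U k), A `<=` \bigcup_k U k &
      \sum_(0 <= k <oo) diam_pow q (U k) < e%:E].

Lemma nneseries_ge_term (u : nat -> \bar R) k : (forall n, 0 <= u n) ->
  u k <= \sum_(0 <= n <oo) u n.
Proof.
move=> u0; apply: (@le_trans _ _ (\sum_(0 <= n < k.+1) u n)).
  by rewrite big_nat_recr//= leeDr// sume_ge0.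
by apply: nneseries_lim_ge => n _ _.
Qed.

(** Sums below a small threshold force diameters below del and below 1, and then
    raising the exponent from q to s only decreases the sums. *)
Lemma hausdorff_le0 q s A : (0 < q)%R -> (q <= s)%R ->
  (forall m : nat, small_cover q m.+1%:R^-1 A) -> hausdorff_measure s A <= 0.
Proof.
move=> q0 qs hA; apply: ge_ereal_sup => _ [del del0 <-].
apply/lee_addgt0Pr => e e0; rewrite add0e.
have m0 : (0 < Num.min e (Num.min (del `^ q) 1))%R.
  by rewrite !lt_min e0 powR_gt0 //= ltr01.
have [m hm] := inv_nat_lt m0.
have [U [oU AU sU]] := hA m.
have {hm sU}sU : \sum_(0 <= k <oo) diam_pow q (U k) <
    (Num.min e (Num.min (del `^ q) 1))%:E by apply: lt_trans sU _; rewrite lte_fin.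
have U_le k : diam_pow q (U k) < (Num.min e (Num.min (del `^ q) 1))%:E.
  apply: le_lt_trans sU; apply: (@nneseries_ge_term
    (fun k => diam_pow q (U k))) => n.
  exact: diam_pow_ge0.
have Uk k : ediam (U k) <= del%:E /\ diam_pow s (U k) <= diam_pow q (U k).
  have [->|/set0P U0] := eqVneq (U k) set0.
    rewrite !diam_pow0; split=> //; apply: ediam_le => x y [].
  have [|r [r0 rE hr]] := diam_pow_fin q0 U0;
    first exact: lt_trans (U_le k) (ltry _).
  move: (U_le k); rewrite !hr rE !lee_fin lte_fin !lt_min => /and3P[_ rd r1].
  have powlt t : (0 < t)%R -> (r `^ q < t `^ q)%R -> (r <= t)%R.
    move=> t0; apply: contraLR; rewrite -!ltNge -leNgt => tr.
    by apply: ge0_ler_powR; rewrite ?nnegrE//; exact: ltW.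
  split; first exact: powlt.
  have r1' : (r <= 1)%R by apply: powlt => //; rewrite powR1.
  have [->|rn0] := eqVneq r 0%R.
    by rewrite !powR0// ?gt_eqF// (lt_le_trans q0).
  by apply: ger_powR => //; rewrite r1' andbT lt_neqAle eq_sym rn0.
apply: (@le_trans _ _ (\sum_(0 <= k <oo) diam_pow s (U k))).
  by apply: ereal_inf_lbound; exists U => //; split=> // k; have [] := Uk k.
apply: (@le_trans _ _ (\sum_(0 <= k <oo) diam_pow q (U k))).
  by apply: lee_nneseries => k *; [exact: diam_pow_ge0|have [] := Uk k].
by apply: (le_trans (ltW sU)); rewrite lee_fin ge_min lexx.
Qed.

(** A ball for the sup norm of radius slightly more than the diameter of U, around
    a point of U.  It multiplies the diameter by a dimensional constant at
    most, up to an error as small as desired. *)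
Lemma open_enlarge q e U : (0 < q)%R -> (0 < e)%R -> diam_pow q U < +oo ->
  exists W, [/\ open W, U `<=` W &
    diam_pow q W <= ((Num.sqrt d%:R * 4) `^ q)%:E * (diam_pow q U + e%:E)].
Proof.
move=> q0 e0 Uoo.
have C0 : (0 <= Num.sqrt d%:R * 4 :> R)%R by rewrite mulr_ge0// sqrtr_ge0.
have [->|/set0P U0] := eqVneq U set0.
  exists set0; split=> //.
  by rewrite diam_pow0 add0e -EFinM lee_fin mulr_ge0 ?powR_ge0// ltW.
have [r [r0 rE hr]] := diam_pow_fin q0 U0 Uoo.
have [x Ux] := U0.
(* t is the margin whose q-th power is e. *)
pose t := (e `^ q^-1)%R; have t0 : (0 < t)%R by exact: powR_gt0.
have te : (t `^ q = e)%R by rewrite -powRrM mulVf ?gt_eqF// powRr1// ltW.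
have rt0 : (0 < r + t)%R by rewrite ltr_wpDl.
exists (ball x (r + t)); split; first exact: ball_open.
  move=> y Uy; apply/rV_ballP => // i.
  have := enorm_coord (x - y) i; rewrite !mxE => /le_lt_trans; apply.
  apply: (@le_lt_trans _ _ r); last by rewrite ltrDl.
  by rewrite -lee_fin -rE; exact: ediam_ge.
have W0 : ball x (r + t) != set0 by apply/set0P; exists x; exact: ballxx.
have dW : ediam (ball x (r + t)) <= (Num.sqrt d%:R * 4 * Num.max r t)%:E.
  apply: ediam_le => y z xy xz; rewrite lee_fin -mulrA; apply: enorm_le.
    by rewrite mulr_ge0// le_max r0.
  move=> i; move: xy xz => /rV_ballP-/(_ rt0 i) + /rV_ballP-/(_ rt0 i).
  have rm : (r <= Num.max r t)%R by rewrite le_max lexx.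
  have tm : (t <= Num.max r t)%R by rewrite le_max lexx orbT.
  by rewrite !mxE ler_norml !ltr_norml; lra.
rewrite hr {1}/diam_pow (negbTE W0).
apply: (@le_trans _ _ ((Num.sqrt d%:R * 4 * Num.max r t)%:E `^ q)).
  apply: gt0_ler_poweR; rewrite ?in_itv/= ?leey ?andbT//; first exact: ltW.
  - by apply: ediam_ge0; apply/set0P.
  - by rewrite lee_fin mulr_ge0// le_max r0.
rewrite poweR_EFin powRM//; last by rewrite le_max r0.
rewrite EFinM -EFinD -EFinM lee_fin ler_wpM2l ?powR_ge0//.
case: (leP r t) => _; first by rewrite te lerDr powR_ge0.
by rewrite lerDl ltW.
Qed.

(** A cover witnessing that the premeasure is small, made open by
    [open_enlarge], with errors summing to at most e'. *)
Lemma small_coverP q e A : (0 < q)%R -> (0 < e)%R ->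
  hausdorff_measure q A <= 0 -> small_cover q e A.
Proof.
move=> q0 e0 HA.
pose C := ((Num.sqrt d%:R * 4) `^ q + 1)%R.
have C0 : (0 < C)%R by rewrite ltr_wpDl// powR_ge0.
pose e' := (e / C / 2)%R; have e'0 : (0 < e')%R by rewrite !divr_gt0.
have : hausdorff_premeasure q 1 A < e'%:E.
  apply: (@le_lt_trans _ _ 0); last by rewrite lte_fin.
  by apply: le_trans HA; apply: ereal_sup_ubound; exists 1%R => //=; rewrite ltr01.
move=> /ereal_inf_lt [_ [U [AU U1] <-] sU].
have Uoo k : diam_pow q (U k) < +oo.
  apply: (@lt_trans _ _ e'%:E); last exact: ltry.
  apply: le_lt_trans sU; apply: (@nneseries_ge_term
    (fun k => diam_pow q (U k))) => n.
  exact: diam_pow_ge0.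
have h k : exists W, [/\ open W, U k `<=` W & diam_pow q W <=
    C%:E * (diam_pow q (U k) + (e' / (2 ^ k.+1)%:R)%:E)].
  have ek : (0 < e' / (2 ^ k.+1)%:R)%R by rewrite divr_gt0// ltr0n expn_gt0.
  have [W [oW UW dW]] := open_enlarge q0 ek (Uoo k).
  exists W; split=> //; apply: le_trans dW _; apply: lee_wpmul2r.
    by rewrite adde_ge0 ?diam_pow_ge0// lee_fin ltW.
  by rewrite lee_fin lerDl.
have [W hW] := choice h.
exists W; split.
- by move=> k; have [] := hW k.
- by apply: subset_trans AU _; apply: subset_bigcup => k _; have [] := hW k.
apply: (@le_lt_trans _ _
  (\sum_(0 <= k <oo) C%:E * (diam_pow q (U k) + (e' / (2 ^ k.+1)%:R)%:E))).
  by apply: lee_nneseries => k *; [exact: diam_pow_ge0|have [] := hW k].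
rewrite nneseriesZl; last first.
  move=> k _; rewrite adde_ge0 ?diam_pow_ge0// lee_fin divr_ge0// ltW//.
apply: (@le_lt_trans _ _ (C%:E * (\sum_(0 <= k <oo) diam_pow q (U k) + e'%:E))).
  apply: lee_wpmul2l; first by rewrite lee_fin ltW.
  by apply: epsilon_trick => [k|]; [exact: diam_pow_ge0|exact: ltW].
apply: (@lt_le_trans _ _ (C%:E * (e'%:E + e'%:E))).
  by rewrite lte_pmul2l// ?lte_fin// lteD2rE.
rewrite -EFinD -EFinM lee_fin /e' -splitr mulrC divfK// gt_eqF//.
Qed.

End hausdorff.

(** * Both sets are countable unions of closed sets *)

Section sigma02.
Variables (R : realType) (d : nat).
Local Notation V := 'rV[R]_d.
Local Notation B := (borel_rV R d).
Implicit Types (p q s c : R).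

Lemma enorm_gt0 (x : V) : x != 0 -> 0 < enorm x.
Proof.
move=> x0; rewrite lt_neqAle enorm_ge0 andbT; apply: contra x0 => /eqP e0.
apply/eqP/rowP => i; rewrite mxE; apply/eqP; rewrite -normr_le0 e0.
exact: enorm_coord.
Qed.

(** The same cover serves for all nearby compact sets. *)
Lemma open_small_cover q e :
  open [set A : K_cube R d | small_cover q e (ambient A)].
Proof.
rewrite openE => A [U [oU AU sU]].
have oUU : open (\bigcup_k U k) by apply: bigcup_open => k _; exact: oU.
have : nbhs A [set E : K_cube R d | ambient E `<=` \bigcup_k U k].
  by apply: open_nbhs_nbhs; split => //; exact: open_ambient_sub.
by apply: filterS => E EU; exists U.
Qed.

Lemma hausdorff_dim_gt_small_cover p (A : set V) : 0 <= p ->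
  (p%:E < hausdorff_dim A)%E <->
  exists n m : nat, ~ small_cover (p + n.+1%:R^-1) m.+1%:R^-1 A.
Proof.
move=> p0; split.
  have /negbTE p0E : ~~ (p%:E < 0)%E by rewrite -leNgt lee_fin.
  rewrite /hausdorff_dim lt_max p0E/=.
  move=> /ereal_sup_gt [_ [s [s0 Hs] <-]]; rewrite lte_fin => ps.
  have [n hn] : exists n : nat, n.+1%:R^-1 < s - p.
    by apply: inv_nat_lt; rewrite subr_gt0.
  exists n; apply: contrapT => /forallNP h.
  have : (hausdorff_measure s A <= 0)%E.
    apply: (@hausdorff_le0 _ _ (p + n.+1%:R^-1)) => [||m].
    - by rewrite ltr_wpDl// invr_gt0.
    - by rewrite -lerBrDl ltW.
    - by apply: contrapT; exact: h.
  by rewrite leNgt Hs.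
move=> [n [m nsc]]; have q0 : 0 < p + n.+1%:R^-1 by rewrite ltr_wpDl// invr_gt0.
have Hq : (0 < hausdorff_measure (p + n.+1%:R^-1) A)%E.
  by rewrite ltNge; apply/negP => H; apply: nsc; apply: small_coverP => //;
    rewrite invr_gt0.
rewrite /hausdorff_dim lt_max; apply/orP; right.
apply: (@lt_le_trans _ _ (p + n.+1%:R^-1)%:E).
  by rewrite lte_fin ltrDl invr_gt0.
by apply: ereal_sup_ubound; exists (p + n.+1%:R^-1) => //; split=> //; exact: ltW.
Qed.

Lemma bigcup2_Sigma02 (X : topologicalType) (C : nat -> nat -> set X) :
  (forall n m, closed (C n m)) -> Sigma02 (\bigcup_n \bigcup_m C n m).
Proof.
move=> cC; exists (fun k => if unpickle k is Some (n, m) then C n m else set0).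
  by move=> k; case: unpickle => [[n m]|]; [exact: cC|exact: closed0].
apply/seteqP; split=> [x [n _ [m _ Cx]]|x [k _]].
  by exists (pickle (n, m)) => //; rewrite pickleK.
by case: unpickle => [[n m] Cx|//]; exists n => //; exists m.
Qed.

Lemma hausdorff_dim_Sigma02 p : 0 <= p ->
  Sigma02 [set A : K_cube R d | (p%:E < hausdorff_dim (ambient A))%E].
Proof.
move=> p0.
have := @bigcup2_Sigma02 (K_cube R d) (fun n m =>
  ~` [set A : K_cube R d | small_cover (p + n.+1%:R^-1) m.+1%:R^-1 (ambient A)]).
rewrite (_ : \bigcup_n _ =
    [set A : K_cube R d | (p%:E < hausdorff_dim (ambient A))%E]).
  by apply => n m; apply: open_closedC; exact: open_small_cover.
apply/seteqP; split=> A /=.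
  by move=> [n _ [m _ nsc]]; apply/hausdorff_dim_gt_small_cover => //; exists n, m.
by move=> /(hausdorff_dim_gt_small_cover _ p0)[n [m nsc]]; exists n => //; exists m.
Qed.

(** The sharp bound is 1, but any constant serves to absorb the low
    frequencies. *)
Lemma normc_ft_le2 (mu : probability B R) (xi : V) :
  Normc.normc (fourier_transform mu xi) <= 2.
Proof.
rewrite normc_le//=.
have bc := bounded_meas_continuous (@cos_phase_continuous R d xi)
  (fun x => norm_cos_le1 _).
have bs := bounded_meas_continuous (@sin_phase_continuous R d xi)
  (fun x => norm_sin_le1 _).
have sq (t : R) : `|t| <= 1 -> t ^+ 2 <= 1.
  by move=> t1; rewrite -(real_normK (num_real t)) expr_le1.
have c1 := sq _ (Rintegral_prob_bound mu bc (fun x => norm_cos_le1 _)).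
have s1 := sq _ (Rintegral_prob_bound mu bs (fun x => norm_sin_le1 _)).
by apply: le_trans (lerD c1 s1) _; rewrite -natrX -(natrD _ 1 1) ler_nat.
Qed.

(** A smaller exponent gives a weaker condition only for frequencies of norm at
    least 1; below that the trivial bound on the transform takes over, hence
    the lower bound 2 on the new constant. *)
Lemma ft_decay_weaken (mu : probability B R) c c' s q : 0 <= q -> q <= s ->
  c <= c' -> 2 <= c' -> ft_decay mu c s -> ft_decay mu c' q.
Proof.
move=> q0 qs cc' c2 h x x0.
have [x1|x1] := leP 1 (enorm x).
  apply: (le_trans (h x x0)); apply: (@le_trans _ _ (c' * enorm x `^ (- s / 2))).
    by rewrite ler_wpM2r ?powR_ge0.
  rewrite ler_wpM2l ?(le_trans _ c2)//; apply: ler_powR => //.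
  by rewrite ler_wpM2r// lerN2.
apply: (le_trans (normc_ft_le2 mu x)); apply: (le_trans c2).
rewrite -[leLHS]mulr1 ler_wpM2l ?(le_trans _ c2)//.
have en0 : 0 < enorm x by exact: enorm_gt0.
rewrite -[leLHS](powRr0 (enorm x)); apply: ger_powR; first by rewrite en0 ltW.
by rewrite mulNr oppr_le0 divr_ge0.
Qed.

(** Constants and exponents are taken from a single sequence.  The exponent is
    truncated at d because the definition only allows exponents up to d, and
    the constant starts at 2 so that [ft_decay_weaken] applies. *)
Lemma fourier_dim_gtP p (A : set V) : 0 <= p < d%:R ->
  p < fourier_dim A <->
  exists n : nat, exists mu : probability B R,
    msupport mu `<=` A /\ ft_decay mu n.+2%:R (Num.min (p + n.+1%:R^-1) d%:R).
Proof.
move=> /andP[p0 pd]; split.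
  rewrite /fourier_dim; set S := [set s | _] => pS.
  have S0 : S !=set0.
    apply: contrapT => /set0P/negP/negPn/eqP SE.
    by move: pS; rewrite SE sup0 ltNge p0.
  have [s [/andP[s0 sd] [mu [smu [c c0 dmu]]]] ps] := sup_gt S0 pS.
  have [n hn] : exists n : nat, n.+1%:R^-1 < s - p.
    by apply: inv_nat_lt; rewrite subr_gt0.
  have [m hm] : exists m : nat, c <= m%:R.
    by exists (Num.trunc c).+1; rewrite ltW// truncnS_gt.
  exists (maxn n m), mu; split=> //; apply: ft_decay_weaken dmu.
  - by rewrite le_min ler0n addr_ge0.
  - rewrite ge_min; apply/orP; left; rewrite -lerBrDl; apply: le_trans (ltW hn).
    by rewrite lef_pV2 ?posrE// ler_nat ltnS leq_maxl.
  - by apply: (le_trans hm); rewrite ler_nat (leq_trans (leq_maxr n m))// leqW.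
  - by rewrite ler_nat.
move=> [n [mu [smu dmu]]].
apply: (@lt_le_trans _ _ (Num.min (p + n.+1%:R^-1) d%:R)).
  by rewrite lt_min pd andbT ltrDl invr_gt0.
apply: ub_le_sup; first by exists d%:R => s [/andP[]].
split; first by rewrite le_min ler0n addr_ge0//= ge_min lexx orbT.
by exists mu; split=> //; exists n.+2%:R.
Qed.

Lemma fourier_dim_Sigma02 p : 0 <= p < d%:R ->
  Sigma02 [set A : K_cube R d | p < fourier_dim (ambient A)].
Proof.
move=> hp; exists (fun n => @decay_set R d n.+2%:R (Num.min (p + n.+1%:R^-1) d%:R)).
  by move=> n; exact: decay_set_closed.
apply/seteqP; split=> A /=.
  by move=> /(fourier_dim_gtP _ hp)[n h]; exists n.
by move=> [n _ h]; apply/fourier_dim_gtP => //; exists n.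
Qed.

End sigma02.

(** * Countable sets have dimension zero *)

Lemma countable_fibres (T : Type) (A : set T) : countable A ->
  exists2 F : nat -> set T, A = \bigcup_n F n &
    forall n x y, F n x -> F n y -> x = y.
Proof.
move=> /countable_injP[f injf]; exists (fun n => A `&` f @^-1` [set n]).
  by apply/seteqP; split=> [x Ax|x [n _ []//]]; exists (f x).
move=> n x y [Ax fx] [Ay fy]; apply: injf; rewrite ?inE//.
by rewrite fx.
Qed.

Section countable.
Variables (R : realType) (d : nat).
Local Notation V := 'rV[R]_d.
Local Notation B := (borel_rV R d).

(** Singletons have diameter 0, and 0^q = 0 as q > 0. *)
Lemma countable_hausdorff_measure (q : R) (A : set V) : 0 < q -> countable A ->
  (hausdorff_measure q A <= 0)%E.
Proof.
move=> q0 /countable_fibres[F AE Fsub].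
have Fd n : (ediam (F n) <= 0)%E.
  apply: ediam_le => x y Fx Fy; rewrite (Fsub n x y Fx Fy) subrr enorm0//.
apply: ge_ereal_sup => _ [del /= del0 <-].
apply: ereal_inf_lbound; exists F.
  split; first by rewrite AE.
  by move=> k; apply: le_trans (Fd k) _; rewrite lee_fin ltW.
apply: eseries0 => k _ _; rewrite /diam_pow; case: ifPn => // /set0P F0.
have -> : ediam (F k) = 0%E by apply/eqP; rewrite eq_le Fd ediam_ge0.
by rewrite poweR0r// gt_eqF.
Qed.

Lemma countable_hausdorff_dim (p : R) (A : set V) : 0 <= p -> countable A ->
  ~ (p%:E < hausdorff_dim A)%E.
Proof.
move=> p0 cA /(hausdorff_dim_gt_small_cover _ p0)[n [m]]; apply.
have q0 : 0 < p + n.+1%:R^-1 by rewrite ltr_wpDl// invr_gt0.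
by apply: small_coverP => //; exact: countable_hausdorff_measure.
Qed.

Lemma Re_le_normc (a b : R) : `|a| <= Normc.normc (Complex a b).
Proof. by rewrite /Normc.normc -sqrtr_sqr ler_sqrt ?lerDl ?addr_ge0 ?sqr_ge0. Qed.

Lemma Im_le_normc (a b : R) : `|b| <= Normc.normc (Complex a b).
Proof. by rewrite /Normc.normc -sqrtr_sqr ler_sqrt ?lerDr ?addr_ge0 ?sqr_ge0. Qed.

Lemma dotpZl (c : R) (x y : V) : dotp (c *: x) y = c * dotp x y.
Proof. by rewrite /dotp mulr_sumr; apply: eq_bigr => i _; rewrite mxE mulrA. Qed.

Lemma dotp_delta (i : 'I_d) (x : V) : dotp (delta_mx ord0 i) x = x ord0 i.
Proof.
rewrite /dotp (bigD1 i)//= mxE !eqxx mul1r big1 ?addr0// => j /negbTE ji.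
by rewrite mxE ji andbF mul0r.
Qed.

Lemma enormZ_delta (c : R) (i : 'I_d) : 0 <= c ->
  enorm (c *: delta_mx ord0 i : V) = c.
Proof.
move=> c0; rewrite /enorm dotpZl dotp_delta !mxE !eqxx mulr1 -expr2.
by rewrite sqrtr_sqr ger0_norm.
Qed.

(** Along multiples of a vector far out on a coordinate axis the transform is
    uniformly small, so no limit is needed in [decay_no_atom]. *)
Lemma decay_small_direction (mu : probability B R) c s e (i : 'I_d) :
  0 < s -> 0 < e -> ft_decay mu c s ->
  exists v : V, forall m : nat, (0 < m)%N ->
    Normc.normc (fourier_transform mu (m%:R *: v)) <= e.
Proof.
move=> s0 e0 h; pose C := `|c| + 1; have C0 : 0 < C by rewrite ltr_wpDl.
pose t := (C / e) `^ (s / 2)^-1.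
have s20 : 0 < s / 2 by rewrite divr_gt0.
have t0 : 0 < t by rewrite powR_gt0// divr_gt0.
have te : t `^ (s / 2) = C / e.
  by rewrite -powRrM mulVf ?gt_eqF// powRr1// divr_ge0// ltW.
(* t is chosen so that C t^(-s/2) = e. *)
exists (t *: delta_mx ord0 i) => m m0.
have mt0 : 0 < m%:R * t by rewrite mulr_gt0// ltr0n.
have mE : enorm (m%:R *: (t *: delta_mx ord0 i) : V) = m%:R * t.
  by rewrite scalerA enormZ_delta// ltW.
have mn0 : m%:R *: (t *: delta_mx ord0 i) != 0 :> V.
  by apply/eqP => m0E; move: mE; rewrite m0E enorm0 => /esym/eqP; rewrite gt_eqF.
apply: (le_trans (h _ mn0)); rewrite mE mulNr powRN.
rewrite ler_pdivrMr ?powR_gt0//.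
apply: (@le_trans _ _ (e * t `^ (s / 2))).
  by rewrite te mulrC divfK ?gt_eqF// (le_trans (ler_norm c))// lerDl.
apply: ler_wpM2l; first exact: ltW.
apply: ge0_ler_powR; rewrite ?nnegrE; try exact: ltW.
by apply: ler_peMl; [exact: ltW|rewrite ler1n].
Qed.

(** A version of Wiener's lemma.  The nonnegative kernel g(x), the square of the
    modulus of the sum of e^(i k th(x)) over k < N, equals N^2 at the atom.
    Expanding the square, its integral is N plus fewer than N^2 terms
    controlled by the transform at nonzero multiples of v, all of them small. *)
Lemma decay_no_atom (mu : probability B R) c s (a : V) : (0 < d)%N ->
  0 < s -> ft_decay mu c s -> mu [set a] = 0%E.
Proof.
move=> d0 s0 h.
have ma : measurable ([set a] : set B).
  by apply: closed_measurable_rV; apply: accessible_closed_set1;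
    exact: hausdorff_accessible.
have mufin : mu [set a] \is a fin_num by exact: fin_num_measure.
suff H (e : R) : 0 < e -> fine (mu [set a]) <= e.
  apply/eqP; rewrite eq_le measure_ge0 andbT -(fineK mufin) lee_fin.
  by apply/ler_addgt0Pr => e e0; rewrite add0r; exact: H.
move=> e0; pose u := e / 3; have u0 : 0 < u by rewrite divr_gt0.
have [v hv] := decay_small_direction (Ordinal d0) s0 u0 h.
have [n hn] := inv_nat_lt u0.
set N := n.+1; have N0 : 0 < N%:R :> R by rewrite ltr0n.
(* th vanishes at the atom. *)
pose al := dotp v a; pose th (x : V) := - dotp v x + al.
have tha : th a = 0 by rewrite /th addNr.
have cth (m : R) : continuous (fun x : V => m * th x).
  move=> x; have ct := continuousD (@phase_continuous R d v x)
    (@cst_continuous _ _ (al : R) x).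
  exact: (continuousM (@cst_continuous _ _ (m : R) x) ct).
have bcos (m : R) : bounded_meas (fun x : B => cos (m * th x)).
  apply: (@bounded_meas_continuous _ _ _ 1) => [x|x]; last exact: norm_cos_le1.
  by apply: (continuous_comp (cth m x)); exact: continuous_cos.
have Icos (j k : nat) : \int[mu]_x cos (j%:R * th x - k%:R * th x)
    <= (j == k)%:R + 2 * u.
  (* The integral of cos (m th) is a combination of the real and imaginary parts
     of the transform at w = m v, with coefficients of modulus at most 1. *)
  have main (m : nat) : (0 < m)%N -> \int[mu]_x cos (m%:R * th x) <= 2 * u.
    move=> m0; have hm := hv m m0.
    pose w := m%:R *: v.
    have bc := bounded_meas_continuous (@cos_phase_continuous R d w)
      (fun x => norm_cos_le1 _).
    have bs := bounded_meas_continuous (@sin_phase_continuous R d w)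
      (fun x => norm_sin_le1 _).
    have -> : \int[mu]_x cos (m%:R * th x) =
        \int[mu]_x (cos (m%:R * al) * cos (- dotp w x) +
          - sin (m%:R * al) * sin (- dotp w x)).
      apply: eq_Rintegral => x _; rewrite /th mulrDr mulrN -dotpZl cosD.
      by rewrite mulNr mulrC [X in _ - X]mulrC.
    rewrite Rintegral_bounded_measD; try by apply: bounded_measM => //;
      exact: bounded_meas_cst.
    rewrite !Rintegral_bounded_measZ//.
    have bnd (r z : R) : `|r| <= 1 -> `|z| <= u -> r * z <= u.
      move=> r1 zu; apply: (le_trans (ler_norm _)); rewrite normrM -[leRHS]mul1r.
      by rewrite ler_pM.
    rewrite (_ : 2 * u = u + u); last by rewrite mulr_natl.
    apply: lerD; apply: bnd; rewrite ?normrN ?norm_cos_le1 ?norm_sin_le1//.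
      exact: le_trans (Re_le_normc _ _) hm.
    exact: le_trans (Im_le_normc _ _) hm.
  have [->|jk] := eqVneq j k.
    under eq_Rintegral do rewrite subrr cos0.
    by rewrite Rintegral_prob_cst lerDl mulr_ge0// ltW.
  rewrite add0r; move: jk; rewrite neq_ltn => /orP[jk|kj].
    under eq_Rintegral do rewrite -cosN opprB -mulrBl -natrB ?(ltnW jk)//.
    by apply: main; rewrite subn_gt0.
  under eq_Rintegral do rewrite -mulrBl -natrB ?(ltnW kj)//.
  by apply: main; rewrite subn_gt0.
have bIcos (j k : nat) :
    bounded_meas (fun x : B => cos (j%:R * th x - k%:R * th x)).
  by have := bcos (j%:R - k%:R); congr bounded_meas; apply/funext => x;
    rewrite mulrBl.
pose g (x : B) : R := \sum_(j < N) \sum_(k < N) cos (j%:R * th x - k%:R * th x).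
(* This is the square of the modulus of an exponential sum, hence nonnegative. *)
have gE x : g x =
    (\sum_(j < N) cos (j%:R * th x)) ^+ 2 + (\sum_(j < N) sin (j%:R * th x)) ^+ 2.
  rewrite !expr2 !big_distrlr/= -big_split/=; apply: eq_bigr => j _.
  by rewrite -big_split/=; apply: eq_bigr => k _; rewrite cosB.
have bg : bounded_meas g by apply: bounded_meas_sum => j;
  apply: bounded_meas_sum => k; exact: bIcos.
have Ig : \int[mu]_x g x <= N%:R + N%:R * (N%:R * (2 * u)).
  rewrite Rintegral_bounded_meas_sum; last by move=> j;
    apply: bounded_meas_sum => k; exact: bIcos.
  apply: (@le_trans _ _ (\sum_(j < N) (1 + N%:R * (2 * u)))); last first.
    by rewrite sumr_const card_ord -[(_ + _) *+ N]mulr_natl mulrDr mulr1.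
  apply: ler_sum => j _; rewrite Rintegral_bounded_meas_sum//.
  apply: (@le_trans _ _ (\sum_(k < N) ((j == k :> nat)%:R + 2 * u))).
    by apply: ler_sum => k _; exact: Icos.
  rewrite big_split/= sumr_const card_ord -[(2 * u) *+ N]mulr_natl lerD2r.
  by rewrite (bigD1 j)//= eqxx big1 ?addr0// => k /negbTE;
    rewrite eq_sym -val_eqE/= => ->.
have hg x : N%:R * N%:R * \1_[set a] x <= g x.
  rewrite indicE; have [->|xa] := eqVneq x a.
    rewrite mem_set// mulr1 /g.
    under eq_bigr do under eq_bigr do rewrite tha !mulr0 subrr cos0.
    by rewrite !sumr_const !card_ord -[N%:R *+ N]mulr_natl.
  by rewrite memNset ?mulr0 ?gE ?addr_ge0 ?sqr_ge0//= => xE; move: xa;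
    rewrite xE eqxx.
have := Rintegral_bounded_meas_le mu
  (bounded_measM (bounded_meas_cst _ (N%:R * N%:R)) (bounded_meas_indic R ma))
  bg hg.
rewrite Rintegral_bounded_measZ ?Rintegral_prob_indic//;
  last exact: bounded_meas_indic.
move=> /le_trans/(_ Ig) H.
apply: (@le_trans _ _ (N%:R^-1 + 2 * u)); last first.
  apply: (@le_trans _ _ (u + 2 * u)); first by rewrite lerD2r ltW.
  by rewrite /u; lra.
rewrite -(ler_pM2l (mulr_gt0 N0 N0)) (le_trans H)// mulrDr.
by rewrite -!mulrA mulfV ?gt_eqF// mulr1.
Qed.

(** A probability supported in a countable closed set charges one of its points,
    which [decay_no_atom] excludes. *)
Lemma countable_fourier_dim (p : R) (A : set V) : (0 < d)%N -> 0 <= p < d%:R ->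
  closed A -> countable A -> ~ p < fourier_dim A.
Proof.
move=> d0 hp cA ctA /(fourier_dim_gtP _ hp)[n [mu [smu dmu]]].
have s0 : 0 < Num.min (p + n.+1%:R^-1) d%:R :> R.
  by rewrite lt_min ltr0n d0 andbT ltr_wpDl ?invr_gt0//; case/andP: hp.
have nullA : mu.-negligible A.
  have [F -> Fsub] := countable_fibres ctA.
  apply: negligible_bigcup => k.
  have [->|/set0P[x Fx]] := eqVneq (F k) set0; first exact: negligible_set0.
  have mx : measurable ([set x] : set B).
    by apply: closed_measurable_rV; apply: accessible_closed_set1;
      exact: hausdorff_accessible.
  have nx : mu.-negligible ([set x] : set B).
    by apply/negligibleP => //; exact: decay_no_atom d0 s0 dmu.
  by apply: negligibleS nx => y Fy; exact: Fsub Fy Fx.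
have mA := closed_measurable_rV cA; have mAC := measurableC mA.
have muA : mu A = 0%E by apply/negligibleP.
have muAC := msupport_null cA smu.
have : mu (A `|` ~` A) = 0%E.
  apply/eqP; rewrite eq_le measure_ge0 andbT.
  by rewrite (le_trans (measureU2 _ _ _))//= muA muAC adde0.
by rewrite setUv (probability_setT mu) => /eqP; rewrite onee_eq0.
Qed.

End countable.

(** * The uniform law on the unit interval *)

Section uniform.
Variable R : realType.
Definition unif : probability _ R := uniform_prob (@ltr01 R).

Lemma unif_le_lebesgue (a b : R) : a <= b ->
  (unif `[a, b]%classic <= (b - a)%:E)%E.
Proof.
move=> ab; rewrite /unif/= /uniform_prob.
apply: (@le_trans _ _ (\int[lebesgue_measure]_(x in `[a, b]) (1%:E))%E).
  apply: ge0_le_integral => //=.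
  - by move=> x _; rewrite lee_fin uniform_pdf_ge0.
  - by apply/measurable_EFinP/measurable_funTS; exact: measurable_uniform_pdf.
  - by move=> x _; rewrite lee_fin /uniform_pdf subr0 invr1; case: ifP.
by rewrite integral_cst//= mul1e lebesgue_measure_itv/=; case: ifPn => // _;
  rewrite lee_fin subr_ge0.
Qed.

Lemma unif01 : unif `[0, 1]%classic = 1%E.
Proof. by rewrite /unif/= /uniform_prob integral_uniform_pdf1//. Qed.

(** A nonnegative integrand makes the change of measure to Lebesgue immediate;
    sines and cosines are shifted by 1 to fall under this case. *)
Lemma Rintegral_unif_FTC2 (f F : R -> R) : continuous f -> (forall t, 0 <= f t) ->
  (forall t : R, is_derive t 1 F (f t)) -> \int[unif]_t f t = F 1 - F 0.
Proof.
move=> cf f0 dF; rewrite /Rintegral integral_uniform; last 2 first.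
- by apply/measurable_EFinP; exact: continuous_measurable_fun.
- by move=> x; rewrite lee_fin.
rewrite subr0 invr1 mul1e (@continuous_FTC2 _ f F 0 1)//.
- exact: continuous_subspaceT.
- have cF t : {for t, continuous F}.
    by apply: differentiable_continuous; apply/derivable1_diffP; have [] := dF t.
  split.
  - by move=> t _; have [] := dF t.
  - exact: cvg_at_right_filter (cF 0).
  - exact: cvg_at_left_filter (cF 1).
- by move=> t _; rewrite derive1E; have [] := dF t.
Qed.

Lemma is_derive_linear (s t : R) : is_derive t 1 (fun t : R => s * t) s.
Proof. by apply: is_derive_eq; rewrite /GRing.scale/= mulr1 ?addr0. Qed.

Lemma linear_phase_continuous (s : R) : continuous (fun t : R => - (s * t)).
Proof.
move=> t; apply: (continuousN (f := fun t => s * t)).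
exact: (continuousM (@cst_continuous _ _ (s : R) t) (@cvg_id _ (nbhs t))).
Qed.

Lemma bounded_meas_cos_linear (s : R) :
  bounded_meas (fun t : measurableTypeR R => cos (- (s * t))).
Proof.
split; last by exists 1 => t; exact: norm_cos_le1.
apply: continuous_measurable_fun => t.
by apply: (continuous_comp (@linear_phase_continuous s t)); exact: continuous_cos.
Qed.

Lemma bounded_meas_sin_linear (s : R) :
  bounded_meas (fun t : measurableTypeR R => sin (- (s * t))).
Proof.
split; last by exists 1 => t; exact: norm_sin_le1.
apply: continuous_measurable_fun => t.
by apply: (continuous_comp (@linear_phase_continuous s t)); exact: continuous_sin.
Qed.

Lemma Rintegral_unif_cos (s : R) : s != 0 ->
  \int[unif]_t cos (- (s * t)) = sin s / s.
Proof.
move=> s0; have := @Rintegral_unif_FTC2 (fun t => 1 + cos (- (s * t)))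
  (id + (fun t => s^-1 * sin (s * t))).
rewrite Rintegral_bounded_measD;
  [|exact: bounded_meas_cst|exact: bounded_meas_cos_linear].
rewrite Rintegral_prob_cst !fctE mulr1 mulr0 sin0 mulr0 addr0 subr0 => H.
apply: (@addrI _ 1); rewrite [sin s / s]mulrC; apply: H => [t|t|t].
- apply: (continuousD (@cst_continuous _ _ (1 : R) t)).
  by apply: (continuous_comp (@linear_phase_continuous s t)); exact: continuous_cos.
- by have := norm_cos_le1 (- (s * t)); rewrite ler_norml => /andP[]; lra.
rewrite cosN; apply: is_deriveD.
have hs := is_derive1_comp (f := sin) (is_derive_sin _) (is_derive_linear s t).
by apply: is_derive_eq; rewrite /GRing.scale/= mulrCA mulVf// mulr1.
Qed.

Lemma Rintegral_unif_sin (s : R) : s != 0 ->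
  \int[unif]_t sin (- (s * t)) = (cos s - 1) / s.
Proof.
move=> s0; have := @Rintegral_unif_FTC2 (fun t => 1 + sin (- (s * t)))
  (id + (fun t => s^-1 * cos (s * t))).
rewrite Rintegral_bounded_measD;
  [|exact: bounded_meas_cst|exact: bounded_meas_sin_linear].
rewrite Rintegral_prob_cst !fctE mulr1 mulr0 cos0 mulr1 add0r => H.
apply: (@addrI _ 1); rewrite mulrBl mul1r [cos s / s]mulrC addrA;
apply: H => [t|t|t].
- apply: (continuousD (@cst_continuous _ _ (1 : R) t)).
  by apply: (continuous_comp (@linear_phase_continuous s t)); exact: continuous_sin.
- by have := norm_sin_le1 (- (s * t)); rewrite ler_norml => /andP[]; lra.
rewrite sinN; apply: is_deriveD.
have hs := is_derive1_comp (f := cos) (is_derive_cos _) (is_derive_linear s t).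
by apply: is_derive_eq; rewrite /GRing.scale/= mulrCA mulVf// mulr1.
Qed.

(** The squared modulus of the transform of the uniform law: one bound for low
    frequencies, one for high frequencies. *)
Lemma unif_ft_bound (s : R) :
  (\int[unif]_t cos (- (s * t))) ^+ 2 + (\int[unif]_t sin (- (s * t))) ^+ 2
  <= 2 /\
  (s != 0 -> (\int[unif]_t cos (- (s * t))) ^+ 2 +
    (\int[unif]_t sin (- (s * t))) ^+ 2 <= 9 / s ^+ 2).
Proof.
have sq (t c : R) : `|t| <= c -> t ^+ 2 <= c ^+ 2.
  move=> tc; rewrite -(real_normK (num_real t)) lerXn2r ?nnegrE//.
  exact: le_trans tc.
split.
  have c1 := sq _ _ (Rintegral_prob_bound unif (bounded_meas_cos_linear s) (fun t
    => norm_cos_le1 _)).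
  have s1 := sq _ _ (Rintegral_prob_bound unif (bounded_meas_sin_linear s) (fun t
    => norm_sin_le1 _)).
  by rewrite (le_trans (lerD c1 s1))// !expr1n.
move=> s0; rewrite Rintegral_unif_cos// Rintegral_unif_sin// !exprMn -mulrDl exprVn.
rewrite ler_wpM2r ?invr_ge0 ?sqr_ge0//.
have h1 := sq _ _ (norm_sin_le1 s).
have h2 : (cos s - 1) ^+ 2 <= 2 ^+ 2.
  by apply: sq; have := norm_cos_le1 s; rewrite !ler_norml => /andP[]; lra.
move: h1 h2; rewrite expr1n -natrX; move: (_ ^+ 2) (_ ^+ 2) => x y; lra.
Qed.

End uniform.

(** * Adding an independent uniform vector *)

Section smear.
Variables (R : realType) (d : nat).
Local Notation V := 'rV[R]_d.
Local Notation B := (borel_rV R d).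
Variables (mu : probability B R) (r : R) (i : 'I_d).

(** The map whose image law is the convolution with a uniform law on a segment of
    length r parallel to the i-th axis. *)
Definition slide (z : V * R) : V := z.1 + (r * z.2) *: delta_mx ord0 i.

Lemma slideE z j : slide z ord0 j = z.1 ord0 j + (r * z.2) *+ (j == i).
Proof. by rewrite !mxE eqxx mulr_natr. Qed.

Lemma measurable_slide :
  measurable_fun [set: B * measurableTypeR R] (slide : _ -> B).
Proof.
apply: measurable_fun_row => j; rewrite (_ : (fun z => _) =
  (fun z : B * measurableTypeR R => (z.1 ord0 j : R) + (r * z.2) *+ (j == i))).
  apply: measurable_funD.
    apply: (@measurableT_comp _ _ _ _ _ _ (fun x : B => x ord0 j : R)).
      by apply: continuous_measurable_rV; exact: coord_continuous_rV.
    exact: measurable_fst.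
  case: (j == i); last exact: (measurable_cst (0 : R)).
  by apply: measurable_funM; [exact: measurable_cst|exact: measurable_snd].
by apply/funext => z; rewrite slideE.
Qed.

Local Notation U := (unif R).

Definition bslide : B * measurableTypeR R -> B := slide.

HB.instance Definition _ :=
  @isMeasurableFun.Build _ _ (B * measurableTypeR R)%type B bslide measurable_slide.

Definition smear : probability B R :=
  distribution ((mu \x U)%E : probability _ R) (bslide : {mfun _ >-> _}).

Lemma smearE (D : set V) : smear D = (mu \x U)%E (slide @^-1` D).
Proof. by []. Qed.

Lemma Rintegral_smear (f : V -> R) : bounded_meas (f : B -> R) ->
  \int[smear]_x f x = \int[(mu \x U)%E]_z f (slide z).
Proof.
move=> bf; congr fine; rewrite integral_distribution//.
  by apply/measurable_EFinP; case: bf.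
apply: (bounded_meas_integrable ((mu \x U)%E : probability _ R) (f := f \o bslide)).
case: bf => mf [M fM]; split; last by exists M => z; exact: fM.
by apply: measurableT_comp => //; exact: measurable_slide.
Qed.

Lemma bounded_meas_prodM (f : V -> R) (g : R -> R) : bounded_meas (f : B -> R) ->
  bounded_meas (g : measurableTypeR R -> R) ->
  bounded_meas (fun z : B * measurableTypeR R => f z.1 * g z.2).
Proof.
move=> bf bg.
apply: (@bounded_measM _ _ _
  (fun z : B * measurableTypeR R => f z.1)
  (fun z : B * measurableTypeR R => g z.2)).
  case: bf => mf [M fM]; split; last by exists M.
  by apply: (measurableT_comp mf); exact: measurable_fst.
case: bg => mg [M gM]; split; last by exists M.
by apply: (measurableT_comp mg); exact: measurable_snd.
Qed.

Lemma Rintegral_prodM (f : V -> R) (g : R -> R) : bounded_meas (f : B -> R) ->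
  bounded_meas (g : measurableTypeR R -> R) ->
  \int[(mu \x U)%E]_z (f z.1 * g z.2) = \int[mu]_x f x * \int[U]_t g t.
Proof.
move=> bf bg.
have bfg := bounded_meas_prodM bf bg.
have ifg := bounded_meas_integrable ((mu \x U)%E : probability _ R) bfg.
rewrite /Rintegral -(integral12_prod_meas1 ifg) /fubini_F/=.
have -> : (\int[mu]_x \int[U]_y (f x * g y)%:E =
    \int[mu]_x ((f x * \int[U]_y g y)%R%:E))%E.
  apply: eq_integral => x _.
  rewrite -(Rintegral_bounded_measZ U (f x) bg) /Rintegral fineK//.
  apply: integrable_fin_num => //; apply: (bounded_meas_integrable U).
  by apply: bounded_measM => //; exact: bounded_meas_cst.
have := Rintegral_bounded_measZ mu (\int[U]_y g y) bf.
rewrite mulrC /Rintegral => <-; congr fine.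
by apply: eq_integral => x _; rewrite mulrC.
Qed.

Lemma slide_phase (xi : V) z :
  - dotp xi (slide z) = - dotp xi z.1 + - (r * xi ord0 i * z.2).
Proof.
rewrite -opprD; congr -%R.
have -> : dotp xi (slide z) = dotp xi z.1 + dotp xi ((r * z.2) *: delta_mx ord0 i).
  by rewrite /dotp -big_split/=; apply: eq_bigr => j _; rewrite mxE mulrDr.
congr (_ + _).
have dC (x y : V) : dotp x y = dotp y x.
  by apply: eq_bigr => j _; rewrite mulrC.
by rewrite dC dotpZl dotp_delta mulrAC.
Qed.

(** The transform of a sum of independent vectors is the product of their
    transforms, by Fubini and the addition formulas. *)
Lemma normc_smear (xi : V) :
  Normc.normc (fourier_transform smear xi) =
  Normc.normc (fourier_transform mu xi) *
  Num.sqrt ((\int[U]_t cos (- (r * xi ord0 i * t))) ^+ 2 +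
            (\int[U]_t sin (- (r * xi ord0 i * t))) ^+ 2).
Proof.
have bc := bounded_meas_continuous (@cos_phase_continuous R d xi)
  (fun x => norm_cos_le1 _).
have bs := bounded_meas_continuous (@sin_phase_continuous R d xi)
  (fun x => norm_sin_le1 _).
set s := r * xi ord0 i.
have bcl := @bounded_meas_cos_linear R s; have bsl := @bounded_meas_sin_linear R s.
rewrite /Normc.normc/= -sqrtrM ?addr_ge0 ?sqr_ge0//; congr Num.sqrt.
rewrite !Rintegral_smear//.
pose P := ((mu \x U)%E : probability _ R).
set a := \int[mu]_x cos _; set b := \int[mu]_x sin _.
set c := \int[U]_t cos _; set e := \int[U]_t sin _.
have -> : \int[(mu \x U)%E]_z cos (- dotp xi (slide z)) = a * c - b * e.
  transitivity (\int[(mu \x U)%E]_z (cos (- dotp xi z.1) * cos (- (s * z.2)) +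
      (- sin (- dotp xi z.1)) * sin (- (s * z.2)))).
    by apply: eq_Rintegral => z _; rewrite slide_phase cosD mulNr.
  rewrite (Rintegral_bounded_measD P);
    [|exact: (bounded_meas_prodM bc bcl)|exact: (bounded_meas_prodM
    (bounded_measN bs) bsl)].
  rewrite (Rintegral_prodM bc bcl) (Rintegral_prodM (bounded_measN bs) bsl).
  have -> : \int[mu]_x - sin (- dotp xi x) = - b.
    by rewrite -mulN1r -Rintegral_bounded_measZ//; apply: eq_Rintegral => x _;
      rewrite mulN1r.
  by rewrite mulNr.
have -> : \int[(mu \x U)%E]_z sin (- dotp xi (slide z)) = b * c + a * e.
  under eq_Rintegral do rewrite slide_phase sinD.
  rewrite (Rintegral_bounded_measD P);
    [|exact: (bounded_meas_prodM bs bcl)|exact: (bounded_meas_prodM bc bsl)].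
  by rewrite (Rintegral_prodM bs bcl) (Rintegral_prodM bc bsl).
ring.
Qed.

End smear.

(** * Probabilities on boxes *)

Section box_measure.
Variables (R : realType) (d : nat).
Local Notation V := 'rV[R]_d.
Local Notation B := (borel_rV R d).

(** For each x, the times t at which the slid point lies in D form a set of
    length at most eta, and an empty set unless x is in D'. *)
Lemma smear_conc (mu : probability B R) r i (D D' : set V) (eta : R) :
  0 <= eta -> measurable (D : set B) -> measurable (D' : set B) ->
  (forall x t, D (slide r i (x, t)) -> D' x) ->
  (forall x : V, exists u, forall t, D (slide r i (x, t)) -> u <= t <= u + eta) ->
  (smear mu r i D <= eta%:E * mu D')%E.
Proof.
move=> eta0 mD mD' h1 h2; rewrite smearE.
have mS : measurable (bslide r i @^-1` D).
  by rewrite -[X in measurable X]setTI;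
    exact: (@measurable_slide R d r i measurableT D mD).
apply: (@le_trans _ _ (\int[mu]_x (eta * \1_D' x)%:E)%E); last first.
  under eq_integral do rewrite EFinM.
  rewrite ge0_integralZl//; first by rewrite integral_indic// setIT.
  by apply/measurable_EFinP; exact: measurable_indic.
apply: ge0_le_integral => //.
- exact: measurable_fun_xsection.
- by apply/measurable_EFinP; apply: measurable_funM;
  [exact: measurable_cst|exact: measurable_indic].
move=> x _ /=.
have [u hu] := h2 x.
have mx : measurable (xsection (bslide r i @^-1` D) x).
  exact: measurable_xsection.
rewrite indicE; have [D'x|nD'x] := pselect (D' x).
  rewrite mem_set// mulr1; apply: (@le_trans _ _ (unif R `[u, u + eta]%classic)).
    apply: le_measure; rewrite ?inE//.
    by move=> t; rewrite /xsection/= inE => Dt; rewrite in_itv/=; exact: hu.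
  have := @unif_le_lebesgue R u (u + eta); rewrite addrAC subrr add0r; apply.
  by rewrite lerDl.
rewrite memNset// mulr0 (_ : xsection _ _ = set0) ?measure0//.
by apply/seteqP; split=> // t; rewrite /xsection/= inE => /h1.
Qed.

Lemma smear_supp (mu : probability B R) r i (D D' : set V) :
  measurable (D : set B) -> measurable (D' : set B) ->
  (forall x t, D' x -> 0 <= t <= 1 -> D (slide r i (x, t))) ->
  mu D' = 1%E -> smear mu r i D = 1%E.
Proof.
move=> mD mD' h muD'; apply/eqP; rewrite eq_le; apply/andP; split;
  first exact: probability_le1.
rewrite smearE.
have mS : measurable (bslide r i @^-1` D).
  by rewrite -[X in measurable X]setTI;
    exact: (@measurable_slide R d r i measurableT D mD).
have <- : (mu \x unif R)%E (D' `*` `[0, 1]%classic) = 1%E.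
  transitivity (mu D' * unif R `[0%R, 1%R]%classic)%E;
    first exact: product_measure1E.
  by rewrite muD' unif01 mule1.
apply: le_measure; rewrite ?inE//; first exact: measurableX.
by move=> [x t] /= [D'x]; rewrite in_itv/= => t01; exact: h.
Qed.

(** The law of the sum of independent uniform vectors on segments of length r,
    with one segment parallel to the i-th axis for each occurrence of i in L. *)
Fixpoint box_prob (r : R) (L : seq 'I_d) : probability B R :=
  if L is i :: L' then smear (box_prob r L') r i else \d_(0 : B).

Definition slab (L : seq 'I_d) (a : 'I_d -> R) (del : R) : set V :=
  [set x | forall i, i \in L -> a i <= x ord0 i <= a i + del].

Lemma coord_itv_closed (P : pred 'I_d) (a b : 'I_d -> R) :
  closed [set x : V | forall i, P i -> a i <= x ord0 i <= b i].
Proof.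
have -> : [set x : V | forall i, P i -> a i <= x ord0 i <= b i] =
    \bigcap_(i in [set i | P i])
      ((fun x : V => x ord0 i) @^-1` `[a i, b i]%classic).
  by apply/seteqP; split=> x h i Pi; have := h i Pi; rewrite /= in_itv.
apply: closed_bigI => i _; apply: closed_comp; last exact: itv_closed.
by move=> x _; exact: coord_continuous_rV.
Qed.

(** Each axis of L contributes one factor, by [smear_conc]: the coordinate along
    a new axis is independent of those already treated. *)
Lemma box_prob_conc r L a del : 0 < r -> 0 <= del -> uniq L ->
  (box_prob r L (slab L a del) <= ((del / r) ^+ size L)%:E)%E.
Proof.
move=> r0 del0; elim: L => [|i L IH] /=.
  by move=> _; rewrite expr0; apply: probability_le1;
    apply: closed_measurable_rV; exact: coord_itv_closed.
move=> /andP[iL uL].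
have dr0 : 0 <= del / r by rewrite divr_ge0// ltW.
have mslab L' : measurable (slab L' a del : set B).
  by apply: closed_measurable_rV; exact: coord_itv_closed.
apply: (le_trans (@smear_conc _ r i _ (slab L a del) (del / r) dr0 (mslab _)
  (mslab _) _ _)).
- move=> x t h j jL; have := h j; rewrite slideE/= inE jL orbT => /(_ isT).
  have /negbTE -> : j != i by apply: contraNneq iL => <-.
  by rewrite mulr0n addr0.
- move=> x; exists ((a i - x ord0 i) / r) => t h.
  have := h i; rewrite slideE/= inE eqxx mulr1n => /(_ isT) /andP[h1 h2].
  rewrite -mulrDl ler_pdivrMr// ler_pdivlMr// mulrC; apply/andP; split; lra.
rewrite exprS [(del / r * _)%:E]EFinM; apply: lee_wpmul2l; first by rewrite lee_fin.
exact: IH.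
Qed.

Definition corner_box (rho : 'I_d -> R) : set V :=
  [set x | forall i, 0 <= x ord0 i <= rho i].

Lemma corner_box_closed rho : closed (corner_box rho).
Proof.
have := @coord_itv_closed xpredT (fun=> 0) rho; congr closed.
by apply/seteqP; split=> x h i; [exact: h|move=> _; exact: h].
Qed.

Lemma corner_box_measurable rho : measurable (corner_box rho : set B).
Proof. by apply: closed_measurable_rV; exact: corner_box_closed. Qed.

Lemma box_prob_supp r L : 0 < r ->
  box_prob r L (corner_box (fun i => r * (count_mem i L)%:R)) = 1%E.
Proof.
move=> r0; elim: L => [|i L IH] /=.
  rewrite /dirac indicE mem_set// => i.
  by rewrite mxE/= mulr0 lexx.
apply: smear_supp IH; [exact: corner_box_measurable..|].
move=> x t h /andP[t0 t1] j; rewrite slideE/= eq_sym.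
have /andP[h0 h1] := h j; case: (i == j) => /=; last first.
  by rewrite mulr0n addr0 add0n h0.
have rt1 : r * t <= r by rewrite ler_piMr// ltW.
have rt0 : 0 <= r * t by rewrite mulr_ge0// ltW.
by rewrite mulr1n natrD mulrDr mulr1; apply/andP; split; lra.
Qed.

(** Each of the factors coming from the i-th axis is at most twice the minimum of
    1 and 3/(r|xi_i|), and all the other ones are at most 2. *)
Lemma box_prob_ft_bound r L (xi : V) i : 0 < r -> xi ord0 i != 0 ->
  Normc.normc (fourier_transform (box_prob r L) xi) <=
  2 * (2 ^+ size L * (Num.min 1 (3 / (r * `|xi ord0 i|))) ^+ count_mem i L).
Proof.
move=> r0 xi0; set m := Num.min _ _.
have rx0 : 0 < r * `|xi ord0 i| by rewrite mulr_gt0// normr_gt0.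
have m0 : 0 <= m by rewrite le_min ler01/= divr_ge0// ltW.
elim: L => [|j L IH]; first by rewrite /= !expr0 !mulr1 normc_ft_le2.
rewrite [box_prob _ _]/= normc_smear.
set K := Num.sqrt _.
have K0 : 0 <= K by exact: sqrtr_ge0.
have [hK2 hKs] := unif_ft_bound (r * xi ord0 j).
have K2 : K <= 2.
  rewrite -(@ger0_norm R 2)// -sqrtr_sqr ler_wsqrtr// (le_trans hK2)//.
  by rewrite -natrX ler_nat.
have Kj : K <= 2 * m ^+ (j == i).
  case: eqP => [ji|_]; last by rewrite expr0 mulr1.
  rewrite expr1 /m; case: (leP 1 (3 / (r * `|xi ord0 i|))) => _.
    by rewrite mulr1.
  apply: (@le_trans _ _ (3 / (r * `|xi ord0 i|))); last first.
    by rewrite ler_peMl ?ler1n// divr_ge0// ltW.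
  have h9 : 0 <= 3 / (r * `|xi ord0 i|) by rewrite divr_ge0// ltW.
  rewrite -(ger0_norm h9) -sqrtr_sqr ler_wsqrtr//.
  have rxj : r * xi ord0 j != 0 by rewrite ji mulf_neq0// gt_eqF.
  apply: (le_trans (hKs rxj)); rewrite ji [leRHS]expr_div_n [in leRHS]exprMn.
  by rewrite real_normK ?num_real// -exprMn -natrX.
apply: (le_trans (ler_pM _ K0 IH Kj)); first exact: sqrtr_ge0.
rewrite [size _]/= [count_mem _ _]/= exprS exprD.
by rewrite le_eqVlt; apply/orP; left; apply/eqP; ring.
Qed.

(** At least one coordinate of xi is comparable to its norm, and the d factors for
    that axis decay like |xi|^(-d), hence at least like |xi|^(-d/2). *)
Lemma box_prob_decay r L : (0 < d)%N -> 0 < r -> (forall i, count_mem i L = d) ->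
  exists2 c, 0 < c & ft_decay (box_prob r L) c d%:R.
Proof.
move=> d0 r0 cL.
have sd0 : 0 < Num.sqrt d%:R :> R by rewrite sqrtr_gt0 ltr0n.
pose b := 3 * Num.sqrt d%:R / r; have b0 : 0 < b by rewrite divr_gt0// mulr_gt0.
exists (2 * 2 ^+ size L * b `^ (d%:R / 2)).
  by rewrite !mulr_gt0// ?exprn_gt0// powR_gt0.
move=> xi xi0; have e0 := enorm_gt0 xi0.
(* The largest coordinate. *)
have [i hi] : exists i : 'I_d, enorm xi <= Num.sqrt d%:R * `|xi ord0 i|.
  case: (@arg_maxP _ _ _ (Ordinal d0) xpredT (fun i => `|xi ord0 i|) isT) => i _ hi.
  by exists i; apply: enorm_le => // j; exact: hi.
have xii : xi ord0 i != 0.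
  by apply/eqP => z; move: hi; rewrite z normr0 mulr0 leNgt e0.
apply: (le_trans (box_prob_ft_bound L r0 xii)); rewrite cL mulrA -!mulrA.
do 2 (rewrite ler_wpM2l ?exprn_ge0//).
set m := Num.min _ _.
have rx0 : 0 < r * `|xi ord0 i| by rewrite mulr_gt0// normr_gt0.
have m0 : 0 < m by rewrite lt_min ltr01/= divr_gt0.
have m1 : m <= 1 by rewrite ge_min lexx.
have mb : m <= b / enorm xi.
  apply: (@le_trans _ _ (3 / (r * `|xi ord0 i|)));
    first by rewrite ge_min lexx orbT.
  rewrite /b ler_pdivlMr// mulrAC ler_pdivrMr//.
  rewrite (_ : _ / r * _ = 3 * (Num.sqrt d%:R * `|xi ord0 i|)); last first.
    by field; rewrite gt_eqF.
  by rewrite ler_pM2l.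
have be0 : 0 <= b / enorm xi by rewrite divr_ge0// ltW.
rewrite -(powR_mulrn _ (ltW m0)).
apply: (@le_trans _ _ (m `^ (d%:R / 2))).
  apply: ger_powR; first by rewrite m0.
  by rewrite ler_pdivrMr// ler_peMr// ler1n.
apply: (@le_trans _ _ ((b / enorm xi) `^ (d%:R / 2))).
  by apply: ge0_ler_powR; rewrite ?nnegrE//; exact: ltW.
rewrite powRM ?invr_ge0; [|exact: ltW|exact: ltW].
rewrite ler_wpM2l ?powR_ge0// -powR_inv1; last exact: ltW.
by rewrite -powRrM mulN1r mulNr.
Qed.

End box_measure.

(** * Boxes have full dimension *)

Section box_dimension.
Variables (R : realType) (d : nat).
Hypothesis d0 : (0 < d)%N.
Local Notation V := 'rV[R]_d.
Local Notation B := (borel_rV R d).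
Variables (rho : R) (A : set V).
Hypotheses (rho0 : 0 < rho) (boxA : corner_box (fun=> rho) `<=` A).

(** Mass distribution principle: the uniform law on the box gives mass at most a
    constant times diam(U)^d to U, so a cover of total weight below the
    inverse of this constant could not cover the box. *)
Lemma box_hausdorff_dim p : p < d%:R -> (p%:E < hausdorff_dim A)%E.
Proof.
move=> pd; have dR0 : 0 < d%:R :> R by rewrite ltr0n.
suff H : (0 < hausdorff_measure d%:R A)%E.
  rewrite /hausdorff_dim lt_max; apply/orP; right.
  apply: (@lt_le_trans _ _ d%:R%:E); first by rewrite lte_fin.
  by apply: ereal_sup_ubound; exists d%:R => //; split=> //; exact: ltW.
rewrite ltNge; apply/negP => H.
pose L := enum 'I_d; pose mu := box_prob rho L.
have sL : size L = d by rewrite size_enum_ord.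
have cL i : count_mem i L = 1 by rewrite count_uniq_mem ?enum_uniq// mem_enum.
pose K := (2 / rho) `^ d%:R; have K0 : 0 < K by rewrite powR_gt0// divr_gt0.
have KV0 : 0 < K^-1 by rewrite invr_gt0.
have [U [oU AU sU]] := small_coverP dR0 KV0 H.
have mU k : measurable (U k : set B) by exact: open_measurable_rV.
have muU k : (mu (U k) <= K%:E * diam_pow d%:R (U k))%E.
  have [->|/set0P Uk0] := eqVneq (U k) set0;
    first by rewrite measure0 diam_pow0 mule0.
  have Ufin : (diam_pow d%:R (U k) < +oo)%E.
    apply: (@lt_trans _ _ K^-1%:E); last exact: ltry.
    apply: le_lt_trans sU; apply: (@nneseries_ge_term _
      (fun k => diam_pow d%:R (U k))) => n.
    exact: diam_pow_ge0.
  have [r [r0 rE ->]] := diam_pow_fin dR0 Uk0 Ufin.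
  have [x Ux] := Uk0.
  apply: (@le_trans _ _ (mu (slab L (fun i => x ord0 i - r) (2 * r)))).
    apply: le_measure; rewrite ?inE//.
      by apply: closed_measurable_rV; exact: coord_itv_closed.
    move=> y Uy i _; have : `|(x - y) ord0 i| <= r.
      by apply: le_trans (enorm_coord _ _) _; rewrite -lee_fin -rE; exact: ediam_ge.
    by rewrite !mxE ler_norml => /andP[]; lra.
  apply: (le_trans (box_prob_conc _ rho0 _ (enum_uniq _)));
    first by rewrite mulr_ge0.
  have h2 : 0 <= 2 / rho by rewrite divr_ge0// ltW.
  by rewrite sL -EFinM lee_fin mulrAC exprMn /K !powR_mulrn.
have muA : (1 <= \sum_(0 <= k <oo) mu (U k))%E.
  rewrite -(box_prob_supp L rho0).
  apply: measure_sigma_subadditive => //; first exact: corner_box_measurable.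
  apply: subset_trans AU; apply: subset_trans boxA => x hx i.
  by have := hx i; rewrite cL mulr1.
have : (1 < 1 :> \bar R)%E; last by rewrite ltxx.
apply: (le_lt_trans muA).
apply: (@le_lt_trans _ _ (\sum_(0 <= k <oo) K%:E * diam_pow d%:R (U k))%E).
  by apply: lee_nneseries => k *; [exact: measure_ge0|exact: muU].
rewrite nneseriesZl; last by move=> k _; exact: diam_pow_ge0.
rewrite -(@lte_pmul2l _ K^-1%:E)// muleA -EFinM mulVf ?gt_eqF// mul1e mule1.
exact: sU.
Qed.

(** Segments of length rho / d, d times along each axis, add up to the box. *)
Lemma box_fourier_dim p : 0 <= p < d%:R -> p < fourier_dim A.
Proof.
move=> hp; have dR0 : 0 < d%:R :> R by rewrite ltr0n.
pose L := flatten (nseq d (enum 'I_d)); pose r := rho / d%:R.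
have r0 : 0 < r by rewrite divr_gt0.
have cL i : count_mem i L = d.
  rewrite /L count_flatten map_nseq count_uniq_mem ?enum_uniq// mem_enum.
  by rewrite sumn_nseq mul1n.
have [c c0 dmu] := box_prob_decay d0 r0 cL.
apply/fourier_dim_gtP => //.
have [n hn] : exists n : nat, c <= n%:R.
  by exists (Num.trunc c).+1; rewrite ltW// truncnS_gt.
exists n, (box_prob r L); split; last first.
  apply: ft_decay_weaken dmu.
  - by rewrite le_min ler0n addr_ge0//; case/andP: hp.
  - by rewrite ge_min lexx orbT.
  - by apply: (le_trans hn); rewrite ler_nat -addn2 leq_addr.
  - by rewrite ler_nat.
apply: subset_trans boxA; apply: null_msupport; first exact: corner_box_closed.
have mO := @corner_box_measurable R d (fun=> rho).
have := probability_setC (box_prob r L) mO.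
have -> : box_prob r L (corner_box (fun=> rho)) = 1%E.
  have := box_prob_supp L r0; congr (box_prob r L _ = _); apply/seteqP.
  by split=> x h i; have := h i; rewrite cL /r divfK// gt_eqF.
by rewrite subee.
Qed.

End box_dimension.

(** * Stages of a closed set in a zero-dimensional space *)

Section clopen_exhaustion.
Variables (R : realType) (X : topologicalType).
Hypotheses (PX : Polish R X) (zX : has_clopen_basis X).

(** For each point s of a countable dense set and each radius 1/(m+1), one clopen
    subset of O containing that ball is selected, if there is one.  Every
    point x of O is caught: take a basic clopen set around x inside O, then s
    close to x and a radius small compared with the size of that set. *)
Lemma open_bigcup_clopen (O : set X) : open O ->
  exists2 W : nat -> set X, (forall k, clopen (W k)) & O = \bigcup_k W k.
Proof.
move=> oO; have [[S cS dS] [rho [_ rhoC rhoT rhoN _]]] := PX.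
have [E [_ bE] Ecl] := zX.
have [F SE Fsub] := countable_fibres cS.
pose bl x (m : nat) := [set y | rho x y < m.+1%:R^-1].
have hW (am : nat * nat) : exists W : set X, [/\ clopen W, W `<=` O &
    forall C, clopen C -> C `<=` O -> (exists2 s, F am.1 s & bl s am.2 `<=` C) ->
    exists2 s, F am.1 s & bl s am.2 `<=` W].
  have [[C [cC CO hC]]|nC] := pselect (exists C, [/\ clopen C, C `<=` O &
      exists2 s, F am.1 s & bl s am.2 `<=` C]).
    by exists C; split.
  exists set0; split => //; first by split; [exact: open0|exact: closed0].
  by move=> C cC CO hC; exfalso; apply: nC; exists C.
have [W hW'] := choice hW.
exists (fun k => if unpickle k is Some am then W am else set0).
  move=> k; case: unpickle => [am|]; last by split; [exact: open0|exact: closed0].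
  by have [] := hW' am.
apply/seteqP; split=> [x Ox|x [k _]]; last first.
  by case: unpickle => [am|//] Wx; have [_ + _] := hW' am; apply.
have [C [EC Cx] CO] : filter_from [set U | E U /\ U x] id O.
  by apply: bE; exact: open_nbhs_nbhs.
have : nbhs x C by apply: open_nbhs_nbhs; split=> //; have [] := Ecl _ EC.
rewrite rhoN => -[e /= e0 eC].
have [m hm] := @inv_nat_lt R (e / 2) (divr_gt0 e0 (ltr0n _ 2)).
have nb : nbhs x (bl x m) by rewrite rhoN; exists m.+1%:R^-1 => //=;
  rewrite invr_gt0.
have [s [Ss xs]] : S `&` (bl x m) !=set0.
  move: nb; rewrite nbhsE => -[Q [oQ Qx] Qb].
  have [s [Qs Ss]] := dS Q (ex_intro _ x Qx) oQ.
  by exists s; split=> //; exact: Qb.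
move: Ss; rewrite SE => -[a _ Fs].
have [_ _ /(_ C (Ecl _ EC) CO)] := hW' (a, m); case.
  exists s => // y /= sy; apply: eC => /=.
  apply: (le_lt_trans (rhoT x s y)); rewrite (splitr e) ltrD//.
    exact: lt_trans hm.
  exact: lt_trans hm.
move=> s' Fs' hs'; exists (pickle (a, m)) => //; rewrite pickleK; apply: hs' => /=.
by rewrite /bl/= (Fsub _ _ _ Fs' Fs) rhoC.
Qed.

(** The clopen sets exhausting the complement of C, made disjoint.  Being clopen,
    they provide locally constant data away from C. *)
Lemma closed_stages (C : set X) : closed C ->
  exists D : nat -> set X, [/\ forall k, clopen (D k),
    forall k x, D k x -> ~ C x, forall j k x, D j x -> D k x -> j = k &
    forall x, ~ C x -> exists k, D k x].
Proof.
move=> cC; have [W Wcl WE] := open_bigcup_clopen (closed_openC cC).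
exists (seqDU W); split.
- move=> k; rewrite /seqDU setDE; apply: clopenI => //; apply: clopenC;
  first exact: set0.
  elim: k => [|k IH]; first by rewrite big_ord0; exact: clopen0.
  by rewrite big_ord_recr/=; apply: clopenU.
- move=> k x [Wx _]; have : (\bigcup_k W k) x by exists k.
  by rewrite -WE.
- move=> j k x Dj Dk; have /trivIsetP tW := trivIset_seqDU W.
  apply: contrapT => /eqP /(tW _ _ I I) jk0.
  by have : (seqDU W j `&` seqDU W k) x by []; rewrite jk0.
move=> x nCx; have : (\bigcup_k W k) x by rewrite -WE.
by rewrite seqDU_bigcup_eq => -[k _ Dx]; exists k.
Qed.

End clopen_exhaustion.

(** * Grids and boxes as pieces *)

Section grid.
Variables (R : realType) (d : nat).
Local Notation V := 'rV[R]_d.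

Definition grid (rho : R) (k : nat) : set V :=
  range (fun g : {ffun 'I_d -> 'I_k.+2} => \row_i (rho * (g i)%:R / k.+1%:R)).

Lemma grid_finite rho k : finite_set (grid rho k).
Proof. by apply: finite_image; exact: finite_finset. Qed.

Lemma grid_closed rho k : closed (grid rho k).
Proof.
apply: (accessible_finite_set_closed.1); last exact: grid_finite.
exact: hausdorff_accessible.
Qed.

Lemma grid_sub_corner_box rho k : 0 <= rho ->
  grid rho k `<=` corner_box (fun=> rho).
Proof.
move=> rho0 _ [g _ <-] i; rewrite mxE; apply/andP; split.
  by rewrite divr_ge0// mulr_ge0.
rewrite ler_pdivrMr// ler_wpM2l// ler_nat; have := ltn_ord (g i).
by rewrite ltnS.
Qed.

Lemma grid0 rho k : grid rho k 0.
Proof. by exists [ffun=> ord0] => //; apply/rowP => i;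
  rewrite !mxE ffunE mulr0 mul0r. Qed.

Lemma corner_box0 rho : 0 <= rho -> corner_box (fun=> rho) (0 : V).
Proof. by move=> rho0 i; rewrite mxE lexx. Qed.

(** Rounding down each coordinate to the grid moves it by at most rho / (k+1). *)
Lemma grid_dense rho (z : V) e : 0 < rho -> 0 < e -> corner_box (fun=> rho) z ->
  exists k0 : nat, forall k, (k0 <= k)%N -> grid rho k `&` ball z e !=set0.
Proof.
move=> rho0 e0 hz.
have [k0 hk0] := inv_nat_lt (divr_gt0 e0 rho0).
exists k0 => k k0k.
have k1 : 0 < k.+1%:R :> R by rewrite ltr0n.
have hk : rho / k.+1%:R < e.
  rewrite mulrC -ltr_pdivlMr//; apply: le_lt_trans hk0.
  by rewrite lef_pV2 ?posrE// ler_nat ltnS.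
pose t i := z ord0 i * k.+1%:R / rho.
have t0 i : 0 <= t i.
  by rewrite divr_ge0 ?mulr_ge0 ?(ltW rho0)//; case/andP: (hz i).
have tk i : (Num.trunc (t i) < k.+2)%N.
  rewrite ltnS -(ler_nat R); apply: (@le_trans _ _ (t i)).
    by case/andP: (truncn_itv (t0 i)).
  by rewrite /t ler_pdivrMr// mulrC ler_pM2l//; case/andP: (hz i).
exists (\row_i (rho * (Num.trunc (t i))%:R / k.+1%:R)); split.
  exists [ffun i => Ordinal (tk i)] => //.
  by apply/rowP => i; rewrite !mxE ffunE.
apply/rV_ballP => // i; rewrite mxE.
have /andP[h1 h2] := truncn_itv (t0 i).
have zE : z ord0 i = rho / k.+1%:R * t i by rewrite /t; field; rewrite !gt_eqF.
have rk0 : 0 < rho / k.+1%:R by rewrite divr_gt0.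
rewrite zE [rho * _%:R / _]mulrAC -mulrBr normrM gtr0_norm//.
apply: le_lt_trans hk; rewrite -[leRHS]mulr1 ler_pM2l// ger0_norm ?subr_ge0//.
by rewrite lerBlDl natr1 ltW.
Qed.

End grid.

Section pieces.
Variables (R : realType) (d : nat) (X : topologicalType).
Local Notation V := 'rV[R]_d.
Variables (rho : R) (C : set X) (D : nat -> set X).
Hypotheses (rho0 : 0 < rho) (Dcl : forall k, clopen (D k))
  (DC : forall k x, D k x -> ~ C x)
  (Ddisj : forall j k x, D j x -> D k x -> j = k)
  (Dcov : forall x, ~ C x -> exists k, D k x).

Definition piece (x : X) : set V :=
  [set z | (C x /\ corner_box (fun=> rho) z) \/ exists2 k, D k x & grid rho k z].

Lemma piece_in x : C x -> piece x = corner_box (fun=> rho).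
Proof.
move=> Cx; apply/seteqP; split=> [z [[]//|[k /DC//]]|z zb].
by left.
Qed.

Lemma piece_stage k x : D k x -> piece x = grid rho k.
Proof.
move=> Dx; apply/seteqP; split=> [z [[Cx _]|[j Dj zg]]|z zg].
- by have := DC Dx.
- by rewrite (Ddisj Dx Dj).
- by right; exists k.
Qed.

Lemma piece_sub_corner_box x : piece x `<=` corner_box (fun=> rho).
Proof. by move=> z [[]//|[k _]]; apply: grid_sub_corner_box; exact: ltW. Qed.

Lemma piece_closed x : closed (piece x).
Proof.
have [Cx|/Dcov[k Dx]] := pselect (C x).
  by rewrite piece_in//; exact: corner_box_closed.
by rewrite (piece_stage Dx); exact: grid_closed.
Qed.

Lemma piece0 x : piece x 0.
Proof.
have [Cx|/Dcov[k Dx]] := pselect (C x).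
  by rewrite piece_in//; apply: corner_box0; exact: ltW.
by rewrite (piece_stage Dx); exact: grid0.
Qed.

Lemma piece_finite x : ~ C x -> finite_set (piece x).
Proof. by move=> /Dcov[k Dx]; rewrite (piece_stage Dx); exact: grid_finite. Qed.

(** The first k0 stages are closed and miss x. *)
Lemma near_late_stage x k0 : C x ->
  \forall x' \near x, forall j, (j < k0)%N -> ~ D j x'.
Proof.
move=> Cx; elim: k0 => [|k0 IH]; first exact: nearW.
have : nbhs x (~` D k0).
  apply: open_nbhs_nbhs; split; last by move=> /DC.
  by rewrite openC; have [] := Dcl k0.
move=> /(filterI IH); apply: filterS => x' [h nD] j.
by rewrite ltnS leq_eqVlt => /orP[/eqP->|/h].
Qed.

Lemma piece_stable k x : D k x -> \forall x' \near x, piece x' = piece x.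
Proof.
move=> Dx; have : nbhs x (D k).
  by apply: open_nbhs_nbhs; split=> //; have [] := Dcl k.
by apply: filterS => x' Dx'; rewrite (piece_stage Dx) (piece_stage Dx').
Qed.

(** Off C the piece is locally constant.  At a point of C, nearby points are in C
    or in a late stage, whose grid is fine enough to meet U. *)
Lemma piece_hit x z (U : set V) : piece x z -> nbhs z U ->
  \forall x' \near x, piece x' `&` U !=set0.
Proof.
have [Cx|/Dcov[k Dx]] := pselect (C x); last first.
  move=> pz /nbhs_singleton Uz; have := piece_stable Dx.
  by apply: filterS => x' ->; exists z.
rewrite {1}piece_in// => zb /nbhs_ballP[e /= e0 eU].
have [k0 hk0] := grid_dense rho0 e0 zb.
have := near_late_stage k0 Cx; apply: filterS => x' hx'.
have [Cx'|/Dcov[k Dx']] := pselect (C x').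
  by exists z; split; [rewrite piece_in|apply: eU; exact: ballxx].
have [|y [yg yb]] := hk0 k.
  by rewrite leqNgt; apply/negP => /hx'.
by exists y; split; [rewrite (piece_stage Dx')|exact: eU].
Qed.

(** At a point of C the piece is as large as it can be. *)
Lemma piece_miss x (F : set V) : piece x `&` F = set0 ->
  \forall x' \near x, piece x' `&` F = set0.
Proof.
have [Cx|/Dcov[k Dx]] := pselect (C x); last first.
  by move=> h; have := piece_stable Dx; apply: filterS => x' ->.
rewrite piece_in// => bF; apply: nearW => x'; apply/seteqP;
  split=> // z [/piece_sub_corner_box zb Fz].
by rewrite -bF.
Qed.

End pieces.

(** * The reduction *)

(** An ultrafilter on the subtype converges as soon as its image does, since the
    topology is induced. *)
Lemma compact_set_type (X : topologicalType) (K : set X) :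
  compact K -> compact [set: set_type K].
Proof.
rewrite !compact_ultra => cK F FU _.
pose v := set_val : set_type K -> X.
have FU' : UltraFilter (v x @[x --> F]) by exact: ultra_fmap.
have [|p [Kp Fp]] := cK _ FU'.
  by rewrite /nbhs/=; apply: (@filterE _ F) => x; exact: set_valP.
exists (SigSub (mem_set Kp)); split=> // W.
rewrite nbhsE => -[Q [[U oU <-] Qp] QW].
apply: (@filterS _ F _ _ _ QW); apply: Fp.
by apply: open_nbhs_nbhs; split.
Qed.

Section cube_valued.
Variables (R : realType) (d : nat) (X : topologicalType).
Local Notation V := 'rV[R]_d.
Variables (C : nat -> set X) (D : nat -> nat -> set X).
Hypotheses (Dcl : forall n k, clopen (D n k))
  (DC : forall n k x, D n k x -> ~ C n x)
  (Ddisj : forall n j k x, D n j x -> D n k x -> j = k)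
  (Dcov : forall n x, ~ C n x -> exists k, D n k x).

Let rho n : R := n.+1%:R^-1.
Let rho0 n : 0 < rho n. Proof. by rewrite invr_gt0. Qed.
Let P n x : set V := @piece R d X (rho n) (C n) (D n) x.

(** All pieces share the origin, and they shrink to it. *)
Definition fan x : set V := \bigcup_n P n x.

Let small_boxes (F : set V) : closed F -> ~ F 0 ->
  exists N : nat, forall n, (N <= n)%N -> corner_box (fun=> rho n) `&` F = set0.
Proof.
move=> cF F0; have : nbhs (0 : V) (~` F).
  by apply: open_nbhs_nbhs; split=> //; exact: closed_openC.
move=> /nbhs_ballP[e /= e0 eF]; have [N hN] := inv_nat_lt e0.
exists N => n Nn; apply/seteqP; split=> // z [zb]; apply: eF.
apply/rV_ballP => // i; rewrite mxE sub0r normrN ger0_norm;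
  last by case/andP: (zb i).
apply: le_lt_trans hN; apply: (@le_trans _ _ (rho n)); first by case/andP: (zb i).
by rewrite lef_pV2 ?posrE// ler_nat ltnS.
Qed.

Let near_all (T : topologicalType) (x : T) (Q : nat -> set T) N :
  (forall n, \forall y \near x, Q n y) ->
  \forall y \near x, forall n, (n < N)%N -> Q n y.
Proof.
move=> h; elim: N => [|N IH]; first exact: nearW.
apply: filterS (filterI IH (h N)) => y [h1 h2] n.
by rewrite ltnS leq_eqVlt => /orP[/eqP->|/h1].
Qed.

Lemma fan0 x : fan x 0.
Proof.
by exists 0%N => //; apply: piece0 => //; [exact: DC|exact: Ddisj|exact: Dcov].
Qed.

(** A closed set missing the union stays away from the origin, so only finitely
    many pieces can come near it. *)
Lemma fan_miss x (F : set V) : closed F -> fan x `&` F = set0 ->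
  \forall x' \near x, fan x' `&` F = set0.
Proof.
move=> cF xF; have F0 : ~ F 0.
  by move=> F0; have : (fan x `&` F) 0; [split=> //; exact: fan0|rewrite xF].
have [N hN] := small_boxes cF F0.
have hn n : \forall x' \near x, P n x' `&` F = set0.
  apply: (piece_miss (rho0 n) (Dcl n) (@DC n) (@Ddisj n) (@Dcov n)).
  apply/seteqP; split=> // z [Pz Fz]; rewrite -xF; split=> //.
  by exists n.
have := near_all N hn; apply: filterS => x' h.
apply/seteqP; split=> // z [[n _ Pz] Fz].
have [nN|Nn] := ltnP n N; first by rewrite -(h n nN).
by rewrite -(hN n Nn); split=> //; exact: piece_sub_corner_box Pz.
Qed.

Lemma fan_hit x z (U : set V) : fan x z -> nbhs z U ->
  \forall x' \near x, fan x' `&` U !=set0.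
Proof.
move=> [n _ Pz] Uz; have :=
  piece_hit (rho0 n) (Dcl n) (@DC n) (@Ddisj n) (@Dcov n) Pz Uz.
by apply: filterS => x' [y [Py Uy]]; exists y; split=> //; exists n.
Qed.

Lemma fan_closed x : closed (fan x).
Proof.
rewrite -openC openE => z nz.
have [i zi] : exists i, z ord0 i != 0.
  apply: contrapT => /forallNP h; apply: nz.
  rewrite (_ : z = 0); first exact: fan0.
  by apply/rowP => i; rewrite mxE; apply/eqP/negPn/negP; exact: h.
have e0 : 0 < `|z ord0 i| / 2 by rewrite divr_gt0// normr_gt0.
have [N hN] := inv_nat_lt e0.
have hn n : \forall y \near z, ~ P n x y.
  have : nbhs z (~` P n x).
    apply: open_nbhs_nbhs; split; last by move=> Pz; apply: nz; exists n.
    apply: closed_openC; apply: piece_closed => //.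
    - exact: DC.
    - exact: Ddisj.
    - exact: Dcov.
  exact.
have hb := nbhsx_ballx z _ e0.
apply: filterS (filterI hb (near_all N hn)) => y [zy hy] [n _ Py].
have [nN|Nn] := ltnP n N; first exact: hy nN Py.
have /(_ i)/andP[y0 yr] := piece_sub_corner_box (rho0 n) Py.
have := proj1 (rV_ballP z y e0) zy i.
have yN : y ord0 i < `|z ord0 i| / 2.
  apply: le_lt_trans hN; apply: (le_trans yr).
  by rewrite lef_pV2 ?posrE// ler_nat ltnS.
have := ler_normD (z ord0 i - y ord0 i) (y ord0 i); rewrite subrK (ger0_norm y0).
move: zi; move: (z ord0 i) (y ord0 i) yN => u w; move: `|u| `|u - w| => nu nuw; lra.
Qed.

Lemma fan_sub_cube x : fan x `<=` @unit_cube R d.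
Proof.
move=> z [n _ /(piece_sub_corner_box (rho0 n)) zb] i; have /andP[-> zr]/= := zb i.
by apply: (le_trans zr); rewrite invf_le1// ler1n.
Qed.

Let cube_set x : set (set_type (@unit_cube R d)) := set_val @^-1` fan x.

Let cube_set_compact x : compact (cube_set x).
Proof.
apply: (@subclosed_compact _ _ setT) => //.
  apply: closed_comp; last exact: fan_closed.
  by move=> y _; exact: set_val_continuous.
by apply: compact_set_type; exact: unit_cube_compact.
Qed.

Definition cube_map x : K_cube R d :=
  @Hyperspace _ (cube_set x) (@cube_set_compact x).

Lemma ambient_cube_map x : ambient (cube_map x) = fan x.
Proof.
apply/seteqP; split=> [_ [z zx <-]//|z zx].
by exists (SigSub (mem_set (fan_sub_cube zx))).
Qed.

Lemma cube_map_continuous : continuous cube_map.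
Proof.
apply: continuous_hyperspace => [F cF|U oU].
  have : open (~` F) by exact: closed_openC.
  move=> [Q oQ QF]; rewrite openE => x xF.
  have QFE (y : set_type (@unit_cube R d)) : Q (set_val y) <-> ~ F y.
    by have := congr1 (fun A => A y) QF; rewrite /= => ->.
  have tF : fan x `&` ~` Q = set0.
    rewrite -ambient_cube_map; apply/seteqP; split=> // _ [[y yx <-] nQ].
    have : (hset (cube_map x) `&` F) y; last by rewrite xF.
    by split=> //; apply: contrapT => nF; apply: nQ; exact/QFE.
  have := fan_miss (open_closedC oQ) tF; apply: filterS => x' x'Q /=.
  apply/seteqP; split=> // y [yx' Fy].
  have : (fan x' `&` ~` Q) (set_val y); last by rewrite x'Q.
  by split=> // /QFE.
(* Opens of the subtype are traces of opens of the ambient space. *)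
have [Q oQ QU] := oU; rewrite openE => x [y [yx Uy]].
have Qy : Q (set_val y) by move: Uy; rewrite -QU.
have nQ : nbhs (set_val y) Q by exact: open_nbhs_nbhs.
have := fan_hit yx nQ; apply: filterS => x' [z [zx' Qz]] /=.
exists (SigSub (mem_set (fan_sub_cube zx'))); split=> //.
by rewrite -QU.
Qed.

Lemma cube_map_box n x : C n x ->
  exists2 r, 0 < r & corner_box (fun=> r) `<=` ambient (cube_map x).
Proof.
move=> Cx; exists (rho n) => //; rewrite ambient_cube_map => z zb.
by exists n => //; rewrite /P piece_in//; exact: DC.
Qed.

Lemma cube_map_countable x : (forall n, ~ C n x) ->
  countable (ambient (cube_map x)).
Proof.
move=> nC; rewrite ambient_cube_map; apply: bigcup_countable => // n _.
apply: finite_set_countable; apply: piece_finite => //.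
- exact: DC.
- exact: Ddisj.
- exact: Dcov.
Qed.

End cube_valued.

(** The only properties of a dimension that hardness needs: it is large on sets
    containing a box around a corner and small on countable sets. *)
Theorem Sigma02_hard_of_box (R : realType) (d : nat) (T : set (K_cube R d)) :
  (forall A : K_cube R d,
    (exists2 r, 0 < r & corner_box (fun=> r) `<=` ambient A) -> T A) ->
  (forall A : K_cube R d, countable (ambient A) -> ~ T A) ->
  pointclass_hard R Sigma02 T.
Proof.
move=> hbox hct X PX zX A [C cC ->].
have [D hD] := choice (fun n => closed_stages PX zX (cC n)).
have Dcl n k : clopen (D n k) by have [h _ _ _] := hD n; exact: h.
have DC n k x : D n k x -> ~ C n x by have [_ h _ _] := hD n; exact: h.
have Ddisj n j k x : D n j x -> D n k x -> j = k.
  by have [_ _ h _] := hD n; exact: h.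
have Dcov n x : ~ C n x -> exists k, D n k x by have [_ _ _ h] := hD n; exact: h.
exists (@cube_map R d X C D DC Ddisj Dcov).
  exact: cube_map_continuous.
move=> x; split=> [[n _ Cx]|Tx].
  by apply: hbox; apply: cube_map_box Cx.
apply: contrapT => nx; apply: hct Tx; apply: cube_map_countable => // n Cx.
by apply: nx; exists n.
Qed.

(** * Completeness *)

Theorem proposition4p5 (R : realType) (d : nat) (hd : (1 <= d)%N)
    (p : R) (hp : 0 <= p < d%:R) :
  pointclass_complete R Sigma02
    [set A : K_cube R d | (p%:E < hausdorff_dim (ambient A))%E] /\
  pointclass_complete R Sigma02
    [set A : K_cube R d | p < fourier_dim (ambient A)].
Proof.
have /andP[p0 pd] := hp; split; split.
- apply: Sigma02_hard_of_box => [A [r r0 rA]|A cA].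
    exact: box_hausdorff_dim rA _ pd.
  exact: countable_hausdorff_dim.
- exact: hausdorff_dim_Sigma02.
- apply: Sigma02_hard_of_box => [A [r r0 rA]|A cA].
    exact: box_fourier_dim rA _ hp.
  by apply: countable_fourier_dim => //; exact: ambient_closed.
- exact: fourier_dim_Sigma02.
Qed.
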